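(* Let $k\ge 3$ and $d\ge 1$ be integers, let $n=(k-1)(2^d-1)$, and set $p=\min\{k,d\}$, $q=\min\{k,d-1\}$. Then $$\dim_{\mathbb F_2}(QP_k)_n \;\ge\; c(k,d):=\sum_{t=1}^{p}\binom kt+(k-3)\binom k2\sum_{u=1}^{q}\binom ku,$$ with equality if and only if either $k=3$, or $k=4$ and $d\ge 5$, or $k=5$ and $d\ge 6$. (An empty sum, e.g. when $q=0$, is $0$.)
   Context: $P_k=\mathbb F_2[x_1,\dots,x_k]$ is the polynomial algebra with each $x_i$ of degree $1$, viewed as a graded module over the mod-2 Steenrod algebra $\mathcal A$ (acting via the Steenrod squares $Sq^i$ with the Cartan formula). $\mathcal A^+$ is the augmentation ideal of $\mathcal A$, and $QP_k=P_k/\mathcal A^+P_k=\mathbb F_2\otimes_{\mathcal A}P_k$. $(QP_k)_n$ denotes the degree-$n$ part of $QP_k$, i.e. the image in $QP_k$ of the homogeneous polynomials of degree $n$. *)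

(* Defs.v *)
From HB Require Import structures.
From mathcomp Require Import all_boot all_order all_algebra.
Set Implicit Arguments. Unset Strict Implicit. Unset Printing Implicit Defensive.
Import GRing.Theory.

(* P_k = F_2[x_1..x_k]; a monomial x_1^{a_1}...x_k^{a_k} is encoded by its
   exponent vector a : 'I_k -> nat (here a k-tuple).  Polynomials of degree n
   are F_2-linear combinations of degree-n monomials. *)

Definition mdeg (a : seq nat) : nat := \sum_(e <- a) e.

(* Exponent vectors of degree n (entries automatically <= n). *)
Definition Mon (k n : nat) : finType :=
  {t : k.-tuple 'I_n.+1 | mdeg (map val t) == n}.

(* Exponent vectors of degree < n: sources of the Steenrod squares
   Sq^i with i = n - deg > 0 landing in degree n. *)
Definition Src (k n : nat) : finType :=
  {t : k.-tuple 'I_n.+1 | mdeg (map val t) < n}.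

(* Coefficient (in F_2) of the monomial x^b in Sq^i(x^a), i = deg b - deg a,
   obtained from Sq^j(x^e) = C(e,j) x^(e+j) and the Cartan formula:
   Sq^i(x^a) = sum_{i_1+..+i_k=i} prod_j C(a_j,i_j) x_j^(a_j+i_j). *)
Definition sq_coef (k : nat) (a b : k.-tuple nat) : 'F_2 :=
  ((\prod_(j < k) ((tnth a j <= tnth b j) * 'C(tnth a j, tnth b j - tnth a j)))%N)%:R%R.

(* Matrix whose rows are the images Sq^{n - deg a}(x^a) (deg a < n) written in
   the monomial basis of (P_k)_n.  Its row space is (A^+ P_k)_n, since
   A^+ P_k = sum_{i>0} Sq^i(P_k) (A^+ is generated by the Sq^i, i > 0) and
   Sq^i is linear. *)
Definition hitmx (k n : nat) : 'M['F_2]_(#|Src k n|, #|Mon k n|) :=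
  \matrix_(s, m) sq_coef (map_tuple val (val (enum_val s)))
                         (map_tuple val (val (enum_val m))).

(* dim_{F_2} (QP_k)_n = dim (P_k)_n - dim (A^+ P_k)_n. *)
Definition dimQP (k n : nat) : nat := (#|Mon k n| - \rank (hitmx k n))%N.

Definition cKD (k d : nat) : nat :=
  (\sum_(1 <= t < (minn k d).+1) 'C(k, t)
   + (k - 3) * 'C(k, 2) * \sum_(1 <= u < (minn k d.-1).+1) 'C(k, u))%N.

(* Main.v *)
(** The total square [Sq] is the substitution [x_i -> x_i + x_i^2], and [(QP_k)_n]
    is dual to the space [KK n] of functionals of degree [n] invariant under [Sq].
    Write [r = k - 1], [X_i] for the product of the variables other than [x_i], and
    [W (i :: w) y = X_i * (W w y)^2].

    Lower bound.  The coefficient of a spike (all exponents of the form [2^s - 1]),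
    taken after a linear substitution, belongs to [KK n].  The substitutions that
    send [x_i0], for some [i0] in [T], to the sum of the other variables of [T] give
    functionals whose value on [W w y] is zero unless [w] is contained in [T].  With
    suitable spikes they are unitriangular on explicit test polynomials, counted by
    [cKD k d].  For [d <= k] with [k >= 4], and for [k >= 6], one more spike
    functional is independent of these.

    Upper bound.  For [k = 3, 4, 5] the chi-trick shows that [f] in [KK n] vanishes
    on [x_B * p^2] unless [#|B| = r], so [f] is determined by the functionals
    [f_w y = f (W w y)].  The hit equations imply that [f_w] depends only on the
    support [S] of [w], and that the sum over [i] of [f_(S + i) (x_i z)] vanishes.
    Descending induction on [S] then shows that [f = 0] as soon as [f] vanishes on
    the test polynomials. *)
Require Import Defs.
From mathcomp Require Import all_boot all_order all_algebra.
From mathcomp Require Import mpoly.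
From mathcomp Require Import zify ring.
Set Implicit Arguments. Unset Strict Implicit. Unset Printing Implicit Defensive.
Import GRing.Theory.
Local Open Scope ring_scope.

(** * Polynomials over F_2, the total square and its invariant functionals *)

Lemma F2_cases (x : 'F_2) : x = 0 \/ x = 1.
Proof. by case: x => [[|[|[]]] //] i; [left|right]; apply/val_inj. Qed.

Lemma F2_neq0 (x : 'F_2) : x != 0 -> x = 1.
Proof. by case: (F2_cases x) => ->. Qed.

Lemma F2_addxx (x : 'F_2) : x + x = 0.
Proof. by case: (F2_cases x) => ->; apply/val_inj. Qed.

Lemma F2_add_eq0 (x y : 'F_2) : x + y = 0 -> x = y.
Proof. by case: (F2_cases x) => ->; case: (F2_cases y) => ->. Qed.

Section Functionals.
Variable k : nat.
Local Notation P := {mpoly 'F_2[k]}.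
Implicit Types (p q u z : P) (m : 'X_{1..k}) (f : P -> 'F_2) (i : 'I_k).

Lemma addpp p : p + p = 0.
Proof. by apply/mpolyP => m; rewrite mcoeffD F2_addxx mcoeff0. Qed.

Lemma oppp p : - p = p.
Proof. by apply/eqP; rewrite eq_sym -addr_eq0 addpp. Qed.

Lemma sqrpD p q : (p + q) ^+ 2 = p ^+ 2 + q ^+ 2.
Proof. by rewrite sqrrD mulr2n addpp addr0. Qed.

Lemma sqrp_sum (I : Type) (s : seq I) (Q : pred I) (F : I -> P) :
  (\sum_(x <- s | Q x) F x) ^+ 2 = \sum_(x <- s | Q x) F x ^+ 2.
Proof.
apply: (big_morph (fun p : P => p ^+ 2)); first exact: sqrpD.
by rewrite expr0n.
Qed.

Lemma mpoly_add_ind (Q : P -> Prop) :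
  Q 0 -> (forall m, Q 'X_[m]) -> (forall p q, Q p -> Q q -> Q (p + q)) ->
  forall p, Q p.
Proof.
move=> Q0 QX QD; elim/mpolyind => // c m p _ /F2_neq0 -> Qp.
by rewrite scale1r; apply: QD.
Qed.

Lemma mpoly_ring_ind (Q : P -> Prop) :
  Q 0 -> Q 1 -> (forall i, Q 'X_i) -> (forall p q, Q p -> Q q -> Q (p + q)) ->
  (forall p q, Q p -> Q q -> Q (p * q)) -> forall p, Q p.
Proof.
move=> Q0 Q1 QX QD QM; apply: mpoly_add_ind => // m.
rewrite mpolyXE_id; elim/big_ind: _ => // i _.
by elim: (m i) => [|e IH]; rewrite ?expr0 // exprS; apply: QM.
Qed.

Fact subst_key : unit. Proof. by []. Qed.

(* Locked because unification would otherwise unfold it very deeply. *)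
Definition subst (l : 'I_k -> P) : P -> P :=
  locked_with subst_key (mmap (mpolyC k (R := 'F_2)) l).

Lemma substE l : subst l = mmap (mpolyC k (R := 'F_2)) l.
Proof. exact: locked_withE. Qed.

Lemma subst0 l : subst l 0 = 0.
Proof. by rewrite substE; apply: rmorph0. Qed.

Lemma subst1 l : subst l 1 = 1.
Proof. by rewrite substE; apply: rmorph1. Qed.

Lemma substD l : {morph subst l : p q / p + q}.
Proof. by rewrite substE; apply: rmorphD. Qed.

Lemma substM l : {morph subst l : p q / p * q}.
Proof. by rewrite substE; apply: rmorphM. Qed.

Lemma substXU l i : subst l 'X_i = l i.
Proof. by rewrite substE mmapX mmap1U. Qed.

Lemma substX l m : subst l 'X_[m] = \prod_i l i ^+ m i.
Proof. by rewrite substE mmapX. Qed.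

Lemma substXn l e : {morph subst l : p / p ^+ e}.
Proof. by rewrite substE; apply: rmorphXn. Qed.

Lemma subst_sum l (I : Type) (s : seq I) (Q : pred I) (F : I -> P) :
  subst l (\sum_(x <- s | Q x) F x) = \sum_(x <- s | Q x) subst l (F x).
Proof. by rewrite substE; apply: rmorph_sum. Qed.

Lemma subst_prod l (I : Type) (s : seq I) (Q : pred I) (F : I -> P) :
  subst l (\prod_(x <- s | Q x) F x) = \prod_(x <- s | Q x) subst l (F x).
Proof. by rewrite substE; apply: rmorph_prod. Qed.

Definition Sq : P -> P := subst (fun i => 'X_i + 'X_i ^+ 2).

Lemma Sq0 : Sq 0 = 0. Proof. exact: subst0. Qed.
Lemma Sq1 : Sq 1 = 1. Proof. exact: subst1. Qed.
Lemma SqD : {morph Sq : p q / p + q}. Proof. exact: substD. Qed.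
Lemma SqM : {morph Sq : p q / p * q}. Proof. exact: substM. Qed.
Lemma SqXn e : {morph Sq : p / p ^+ e}. Proof. exact: substXn. Qed.
Lemma Sq_sum (I : Type) (s : seq I) (Q : pred I) (F : I -> P) :
  Sq (\sum_(x <- s | Q x) F x) = \sum_(x <- s | Q x) Sq (F x).
Proof. exact: subst_sum. Qed.
Lemma Sq_prod (I : Type) (s : seq I) (Q : pred I) (F : I -> P) :
  Sq (\prod_(x <- s | Q x) F x) = \prod_(x <- s | Q x) Sq (F x).
Proof. exact: subst_prod. Qed.

Lemma SqXU i : Sq 'X_i = 'X_i + 'X_i ^+ 2.
Proof. exact: substXU. Qed.

Lemma SqX m : Sq 'X_[m] = \prod_i ('X_i + 'X_i ^+ 2) ^+ m i.
Proof. exact: substX. Qed.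

(* The dual of (QP_k)_n: functionals on degree n that kill the hit polynomials.
   For [p] of degree less than [n], [f (Sq p) = f p] says [f (Sq^i p) = 0]
   with [i = n - deg p]. *)
Record KK (n : nat) f : Prop := IsKK {
  KKD : {morph f : p q / p + q};
  KKS : forall p, f (Sq p) = f p;
  KKdeg : forall m, mdeg m != n -> f 'X_[m] = 0 }.

Lemma KK0 n f : KK n f -> f 0 = 0.
Proof.
move=> [fD _ _]; apply/(@addrI _ (f 0)).
by rewrite -fD !addr0.
Qed.

Lemma KK_sum n f (I : Type) (s : seq I) (Q : pred I) (F : I -> P) :
  KK n f -> f (\sum_(x <- s | Q x) F x) = \sum_(x <- s | Q x) f (F x).
Proof. by move=> Kf; apply: (big_morph f (KKD Kf) (KK0 Kf)). Qed.

Lemma KK_homog n f d p : KK n f -> p \is d.-homog -> d != n -> f p = 0.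
Proof.
move=> Kf /dhomogP hp dn; rewrite [p]mpolyE (KK_sum _ _ _ Kf) big_seq big1 //.
move=> m pm; have := pm; rewrite mcoeff_msupp => /F2_neq0 ->.
by rewrite scale1r (KKdeg Kf) // (hp m pm).
Qed.

Lemma addf_ext f g : {morph f : p q / p + q} -> {morph g : p q / p + q} ->
  (forall m, f 'X_[m] = g 'X_[m]) -> f =1 g.
Proof.
move=> fD gD fg; elim/mpoly_add_ind => // [|p q fp fq].
  have z (h : P -> 'F_2) : {morph h : p q / p + q} -> h 0 = 0.
    by move=> hD; apply/(@addrI _ (h 0)); rewrite -hD !addr0.
  by rewrite !z.
by rewrite fD gD fp fq.
Qed.

(** Distributing the product amounts to choosing one exponent per variable; the only choice that
    produces the monomial [m] is [m] itself. *)
Lemma mcoeff_prodX (N : nat) (c : 'I_k -> nat -> 'F_2) m :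
  (forall i, m i < N)%N ->
  (\prod_i \sum_(e < N) c i e *: 'X_i ^+ e : P)@_m = \prod_i c i (m i).
Proof.
move=> mN; rewrite bigA_distr_bigA /= linear_sum /=.
have E (g : {ffun 'I_k -> 'I_N}) :
    \prod_i (c i (g i) *: 'X_i ^+ g i : P) =
    (\prod_i c i (g i)) *: 'X_[[multinom (g i : nat) | i < k]].
  rewrite scaler_prod mpolyXE_id; congr (_ *: _).
  by apply: eq_bigr => i _; rewrite mnmE.
under eq_bigr => g _ do rewrite E mcoeffZ mcoeffX.
pose g0 := [ffun i => Ordinal (mN i)].
rewrite (bigD1 g0) //= [X in _ + X]big1 => [|g /eqP ng].
  rewrite addr0; have -> : [multinom (g0 i : nat) | i < k] = m.
    by apply/mnmP => i; rewrite mnmE ffunE.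
  by rewrite eqxx mulr1; apply: eq_bigr => i _; rewrite ffunE.
case: eqP => [gm|]; last by rewrite mulr0.
case: ng; apply/ffunP => i; apply/val_inj; rewrite ffunE /=.
by rewrite -gm mnmE.
Qed.

(** This ties the substitution [Sq] to [sq_coef]: both are the same product of binomials. Each
    factor (x + x^2)^a is the sum of C(a,j) x^(a+j), padded with zero coefficients to a common range
    so that [mcoeff_prodX] applies. *)
Lemma mcoeff_SqX m m' : (Sq 'X_[m])@_m' =
  \prod_i ((m i <= m' i)%N * 'C(m i, m' i - m i))%:R.
Proof.
pose N := (\max_i (2 * m i + m' i).+1)%N.
have NP i : (2 * m i + m' i < N)%N by apply: (leq_bigmax (F := fun i => (2 * m i + m' i).+1)%N).
rewrite SqX.
under eq_bigr => i _.
  rewrite (_ : ('X_i + 'X_i ^+ 2) ^+ m i = \sum_(e < N)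
     (((m i <= e)%N * 'C(m i, e - m i))%:R : 'F_2) *: 'X_i ^+ e); last first.
  rewrite exprDn -(big_mkord xpredT (fun j => 'X_i ^+ (m i - j) * 'X_i ^+ 2 ^+ j *+ 'C(m i, j))).
  rewrite -(big_mkord xpredT (fun e => ((m i <= e)%N * 'C(m i, e - m i))%:R *: 'X_i ^+ e)).
  rewrite [RHS](@big_cat_nat _ _ _ (m i)) //=; last by have := NP i; lia.
  rewrite [X in X + _]big1_seq ?add0r => [|e]; last first.
    rewrite mem_index_iota => /andP[_ /andP[_ em]]; rewrite leqNgt em /=.
    by rewrite mul0n scale0r.
  rewrite [RHS](@big_cat_nat _ _ _ (m i + (m i).+1)) /=; first last.
  - by have := NP i; lia.
  - lia.
  rewrite [X in _ = _ + X]big1_seq ?addr0 => [|e]; last first.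
    rewrite mem_index_iota => /andP[_ /andP[em _]].
    by rewrite bin_small ?muln0 ?scale0r //; lia.
  rewrite -[X in index_iota X (_ + _)]add0n big_addn addKn.
  rewrite !big_nat; apply: eq_bigr => j /andP[_ jm].
  rewrite addnK leq_addl mul1n -exprM -exprD scaler_nat; congr (_ ^+ _ *+ _); lia.
  over.
rewrite (mcoeff_prodX (fun i e => ((m i <= e)%N * 'C(m i, e - m i))%:R)) //.
by move=> i; have := NP i; lia.
Qed.

End Functionals.

(** * The dimension of QP_k through dual functionals *)

Section Dual.
Variables k n : nat.
Local Notation P := {mpoly 'F_2[k]}.
Local Notation M := #|Mon k n|.

Definition mon_of (j : 'I_M) : 'X_{1..k} :=
  [multinom (tnth (val (enum_val j)) i : nat) | i < k].

Lemma mdeg_of_tuple (t : k.-tuple 'I_n.+1) :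
  Defs.mdeg (map val t) = mdeg [multinom (tnth t i : nat) | i < k].
Proof.
rewrite /Defs.mdeg mdegE big_map big_tuple.
by apply: eq_bigr => i _; rewrite mnmE.
Qed.

Lemma mdeg_mon_of j : mdeg (mon_of j) = n.
Proof. by rewrite -mdeg_of_tuple; apply/eqP/(valP (enum_val j)). Qed.

Lemma mnm_le_mdeg (m : 'X_{1..k}) i : (m i <= mdeg m)%N.
Proof. by rewrite mdegE (bigD1 i) //= leq_addr. Qed.

Lemma mon_of_surj (m : 'X_{1..k}) : mdeg m = n -> exists j, mon_of j = m.
Proof.
move=> mn; pose t := [tuple (inord (m i) : 'I_n.+1) | i < k].
have tm : [multinom (tnth t i : nat) | i < k] = m.
  apply/mnmP => i; rewrite mnmE tnth_mktuple inordK // ltnS -mn.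
  exact: mnm_le_mdeg.
have tP : Defs.mdeg (map val t) == n by rewrite mdeg_of_tuple tm mn.
exists (enum_rank (exist _ t tP : Mon k n)).
by rewrite /mon_of enum_rankK.
Qed.

Lemma mon_of_inj : injective mon_of.
Proof.
move=> j j' e; apply/enum_val_inj/val_inj/eq_from_tnth => i; apply/val_inj.
by have /(congr1 (fun m : 'X_{1..k} => m i)) := e; rewrite !mnmE.
Qed.

(** Every monomial of Sq x^a dominates [a] exponentwise, so one of degree at most deg a must be
    x^a. *)
Lemma mcoeff_Sq_ge (a b : 'X_{1..k}) : (mdeg b <= mdeg a)%N ->
  (Sq 'X_[a])@_b = (a == b)%:R.
Proof.
move=> ba; rewrite mcoeff_SqX; case: eqP => [<-|ab].
  by rewrite big1 // => i _; rewrite leqnn subnn bin0.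
have [/forallP le_ab|] := boolP [forall i, a i <= b i]%N.
  case: ab; apply/mnmP => i.
  have : (\sum_i (b i - a i) = 0)%N.
    by rewrite sumnB // -!mdegE; apply/eqP; rewrite subn_eq0.
  move/eqP; rewrite sum_nat_eq0 => /forallP /(_ i) /= /eqP.
  by have := le_ab i; lia.
rewrite negb_forall => /existsP[i /negPf nle].
by rewrite (bigD1 i) //= nle mul0n mul0r.
Qed.

Definition ev (v : 'rV['F_2]_M) (p : P) : 'F_2 := \sum_j v 0 j * p@_(mon_of j).

Lemma ev_add v : {morph ev v : p q / p + q}.
Proof.
move=> p q; rewrite /ev -big_split; apply: eq_bigr => j _.
by rewrite mcoeffD mulrDr.
Qed.

Lemma evX v j : ev v 'X_[mon_of j] = v 0 j.
Proof.
rewrite /ev (bigD1 j) //= mcoeffX eqxx mulr1 big1 ?addr0 // => i ij.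
by rewrite mcoeffX (inj_eq mon_of_inj) eq_sym (negPf ij) mulr0.
Qed.

Lemma ev_deg v m : mdeg m != n -> ev v 'X_[m] = 0.
Proof.
move=> mn; rewrite /ev big1 // => j _; rewrite mcoeffX.
by case: eqP => [e|_]; rewrite ?mulr0 //; rewrite e mdeg_mon_of eqxx in mn.
Qed.

Lemma KK_evE f : KK n f -> f =1 ev (\row_j f 'X_[mon_of j]).
Proof.
move=> Kf; apply: addf_ext => [||m]; [exact: KKD Kf | exact: ev_add |].
have [/mon_of_surj[j <-]|mn] := eqVneq (mdeg m) n; first by rewrite evX mxE.
by rewrite (KKdeg Kf) // ev_deg.
Qed.

(** The rows of [hitmx] are the degree-[n] parts of Sq x^a with deg a < n, so the kernel of its
    transpose is the space of functionals vanishing on hit polynomials. *)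
Lemma hit_ev v : (v *m (hitmx k n)^T = 0) <->
  (forall m, (mdeg m < n)%N -> ev v (Sq 'X_[m]) = 0).
Proof.
have E (s : Src k n) : (v *m (hitmx k n)^T) 0 (enum_rank s) =
    ev v (Sq 'X_[[multinom (tnth (val s) i : nat) | i < k]]).
  rewrite mxE; apply: eq_bigr => j _; rewrite !mxE mcoeff_SqX /sq_coef.
  congr (_ * _); rewrite natr_prod; apply: eq_bigr => i _.
  by rewrite !tnth_map !mnmE enum_rankK.
split=> [h m mn|h]; last first.
  apply/rowP => s; rewrite -(enum_valK s) E h ?mxE //.
  by rewrite -mdeg_of_tuple; apply: (valP (enum_val s)).
pose t := [tuple (inord (m i) : 'I_n.+1) | i < k].
have tm : [multinom (tnth t i : nat) | i < k] = m.
  apply/mnmP => i; rewrite mnmE tnth_mktuple inordK // ltnS.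
  exact: leq_trans (mnm_le_mdeg _ _) (ltnW mn).
have tP : (Defs.mdeg (map val t) < n)%N by rewrite mdeg_of_tuple tm.
by rewrite -tm -(E (exist _ t tP : Src k n)) h mxE.
Qed.

Lemma ev_KK v : v *m (hitmx k n)^T = 0 -> KK n (ev v).
Proof.
move=> /hit_ev h; split=> [||m]; [exact: ev_add | | exact: ev_deg].
apply: addf_ext => [p q|p q|m]; rewrite ?SqD ?ev_add //.
have [mn|nm] := ltnP (mdeg m) n; first by rewrite h // ev_deg ?neq_ltn ?mn.
apply: eq_bigr => j _; rewrite mcoeff_Sq_ge ?mcoeffX //.
by rewrite mdeg_mon_of.
Qed.

Lemma KK_hit f : KK n f -> (\row_j f 'X_[mon_of j]) *m (hitmx k n)^T = 0.
Proof.
move=> Kf; apply/hit_ev => m mn.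
by rewrite -(KK_evE Kf) (KKS Kf) (KKdeg Kf) // neq_ltn mn.
Qed.

(** A unitriangular pairing with the tests [t] makes the functionals independent: in a vanishing
    combination, evaluate at the test of an index of maximal [key] among the nonzero coefficients,
    and only its own term survives. *)
Lemma dimQP_ge (I : finType) (phi : I -> P -> 'F_2) (t : I -> P)
    (key : I -> nat) :
  (forall x, KK n (phi x)) -> (forall x, phi x (t x) = 1) ->
  (forall x y, phi x (t y) != 0 -> x != y -> (key y < key x)%N) ->
  (#|I| <= dimQP k n)%N.
Proof.
move=> Kphi diag tri.
pose V : 'M['F_2]_(#|I|, M) := \matrix_(a, j) phi (enum_val a) 'X_[mon_of j].
have Vhit : V *m (hitmx k n)^T = 0.
  apply/row_matrixP => a; rewrite row_mul row0 -(KK_hit (Kphi (enum_val a))).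
  by congr (_ *m _); apply/rowP => j; rewrite !mxE.
have := mulmx0_rank_max Vhit; rewrite mxrank_tr => rk.
rewrite /dimQP leq_subRL ?rank_leq_col // addnC.
suff /eqP <- : \rank V == #|I| by [].
rewrite -[_ == _]/(row_free V) -kermx_eq0; apply/rowV0P => w /sub_kermxP wV.
have wt p : \sum_a w 0 a * phi (enum_val a) p = 0.
  transitivity (ev (w *m V) p); last first.
    by rewrite wV /ev big1 // => j _; rewrite mxE mul0r.
  under eq_bigr => a _ do rewrite (KK_evE (Kphi _)) /ev big_distrr /=.
  rewrite exchange_big; apply: eq_bigr => j _.
  by rewrite mxE mulr_suml; apply: eq_bigr => a _; rewrite !mxE mulrA.
apply/rowP => a0; rewrite mxE; apply/eqP; apply: contraT => w0.
case: (arg_maxnP (P := fun a => w 0 a != 0) (fun a => key (enum_val a)) w0).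
move=> a wa amax; have := wt (t (enum_val a)).
rewrite (bigD1 a) //= diag mulr1 big1 => [/eqP|b ba].
  by rewrite addr0 (negPf wa).
apply/eqP; rewrite mulf_eq0; apply: contraT; rewrite negb_or => /andP[wb pb].
have /tri := pb; rewrite (inj_eq enum_val_inj) => /(_ ba).
by rewrite ltnNge => /negP[]; apply: amax.
Qed.

(** Evaluation at the tests is an injective linear map from the kernel of the transposed hit matrix
    to a space of dimension [#|I|]. *)
Lemma dimQP_le (I : finType) (t : I -> P) :
  (forall f, KK n f -> (forall x, f (t x) = 0) -> forall p, f p = 0) ->
  (dimQP k n <= #|I|)%N.
Proof.
move=> ht; pose K := kermx (hitmx k n)^T.
pose T : 'M['F_2]_(M, #|I|) := \matrix_(j, a) (t (enum_val a))@_(mon_of j).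
have -> : dimQP k n = \rank K by rewrite mxrank_ker mxrank_tr.
rewrite -(mxrank_mul_ker K T) (_ : (K :&: kermx T)%MS = 0) ?mxrank0 ?addn0.
  exact: rank_leq_col.
apply/eqP/rowV0P => v; rewrite sub_capmx => /andP[/sub_kermxP vK /sub_kermxP vT].
apply/rowP => j; rewrite -evX mxE; apply: (ht _ (ev_KK vK)) => x.
have /rowP /(_ (enum_rank x)) := vT; rewrite !mxE => <-.
by apply: eq_bigr => i _; rewrite !mxE enum_rankK.
Qed.

End Dual.

(** * Parity of binomial coefficients *)

Lemma odd_bin_double a c : odd 'C(a.*2.+1, c.*2) = odd 'C(a, c).
Proof.
have step n j : odd 'C(n.+2, j.+2) = odd 'C(n, j.+2) (+) odd 'C(n, j).
  rewrite (binS n.+1 j.+1) (binS n j.+1) (binS n j) !oddD.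
  by rewrite addbA -[X in X (+) _]addbA addbb addbF.
elim: a c => [|a IH] [|c]; rewrite ?bin0 //.
by rewrite !doubleS step -doubleS !IH binS oddD.
Qed.

(** Induction on [s] by halving. For odd [a] the binomial reduces modulo 2 to the one for a/2. For
    even [a] the lower index j is odd, and j C(a,j) = a C(a-1,j-1) is even. *)
Lemma odd_bin_spike s a : (a < 2 ^ s - 1)%N -> ~~ odd 'C(a, 2 ^ s - 1 - a).
Proof.
elim: s a => [|s IH] a //; rewrite expnS mul2n => lt_a.
have s0 := expn_gt0 2 s; rewrite /= in s0.
case oa: (odd a); have := odd_double_half a; rewrite oa /= => ea.
  have -> : ((2 ^ s).*2 - 1 - a = (2 ^ s - 1 - a./2).*2)%N by lia.
  by rewrite -{1}ea add1n odd_bin_double IH //; lia.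
have ja : odd ((2 ^ s).*2 - 1 - a).
  have -> : ((2 ^ s).*2 - 1 - a = (2 ^ s - 1 - a./2).*2.+1)%N by lia.
  by rewrite /= odd_double.
case: a => [|a] in oa ea ja lt_a *; first by rewrite bin_small //; lia.
move: ja; case: (_ - _)%N => // j oj.
have /(congr1 odd) := mul_bin_diag a.+1 j; rewrite !oddM.
by rewrite (oa : odd a.+1 = false) (oj : odd j.+1 = true) /= => <-.
Qed.

(** * Linear substitutions and spikes *)

Section Substitutions.
Variable k : nat.
Local Notation P := {mpoly 'F_2[k]}.
Implicit Types (p q u z : P) (m : 'X_{1..k}) (i : 'I_k) (B O : {set 'I_k}).
Implicit Types (l : 'I_k -> P).

Definition ind B : 'X_{1..k} := [multinom (i \in B : nat) | i < k].
(** Exponents of x_B (x^m)^2. Every exponent vector has this form for exactly one pair, [B] being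
    the set of its odd entries. *)
Definition msq B m := (ind B + m *+ 2)%MM.
Definition xs B : P := \prod_(i in B) 'X_i.

Lemma xsE B : xs B = 'X_[ind B].
Proof.
rewrite mpolyXE_id /xs big_mkcond; apply: eq_bigr => i _; rewrite mnmE.
by case: (i \in B); rewrite ?expr1 ?expr0.
Qed.

Lemma mpolyX_msq B m : 'X_[msq B m] = xs B * 'X_[m] ^+ 2 :> P.
Proof. by rewrite mpolyXD xsE mpolyXn. Qed.

Lemma mdeg_ind B : mdeg (ind B) = #|B|.
Proof.
rewrite mdegE -sum1_card [RHS]big_mkcond.
by apply: eq_bigr => i _; rewrite mnmE; case: (i \in B).
Qed.

Lemma mdeg_msq B m : mdeg (msq B m) = (#|B| + 2 * mdeg m)%N.
Proof. by rewrite mdegD mdeg_ind mdegMn mulnC. Qed.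

Lemma msqE B m i : msq B m i = ((i \in B) + 2 * m i)%N.
Proof. by rewrite mnmDE mulmnE mnmE mulnC. Qed.

Lemma msq_inj B B' m m' : msq B m = msq B' m' -> B = B' /\ m = m'.
Proof.
move=> e; have h i : ((i \in B) + 2 * m i = (i \in B') + 2 * m' i)%N.
  by rewrite -!msqE e.
split; last by apply/mnmP => i; have := h i; do 2!case: (_ \in _); lia.
by apply/setP => i; have := h i; do 2!case: (_ \in _) => //; lia.
Qed.

Lemma msq_surj m : exists B m', m = msq B m'.
Proof.
exists [set i | odd (m i)], [multinom (m i)./2 | i < k].
by apply/mnmP => i; rewrite msqE inE mnmE mul2n odd_double_half.
Qed.

Lemma ind_inj : injective ind.
Proof.
move=> B B' e; have : msq B 0%MM = msq B' 0%MM by rewrite /msq e.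
by case/msq_inj.
Qed.

Lemma msq0 B : msq B 0%MM = ind B.
Proof. by apply/mnmP => i; rewrite msqE !mnmE muln0 addn0. Qed.

Lemma xs_homog B : xs B \is (#|B|).-homog.
Proof. by rewrite xsE dhomogX /= mdeg_ind. Qed.

Lemma xsD1 B i : i \in B -> xs B = 'X_i * xs (B :\ i).
Proof. by move=> iB; rewrite /xs (big_setD1 i). Qed.

Lemma xsU1 B i : i \notin B -> 'X_i * xs B = xs (i |: B).
Proof. by move=> iB; rewrite [RHS](@xsD1 _ i) ?setU11 // setU1K. Qed.

(* A monomial with odd exponents exactly on [O] has degree at least [#|O|], so
   only the squarefree monomial [ind O] of [u] can contribute. *)
Lemma mcoeff_mul_sqr u p d O m : u \is d.-homog -> (d <= #|O|)%N ->
  (u * p ^+ 2)@_(msq O m) = u@_(ind O) * p@_m.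
Proof.
move=> /dhomogP hu dO.
rewrite [u in LHS]mpolyE [u in RHS]mpolyE mulr_suml !linear_sum /= mulr_suml.
rewrite !big_seq; apply: eq_bigr => m1 /hu /= dm1.
rewrite -scalerAl !mcoeffZ -mulrA; congr (_ * _); rewrite mcoeffX.
elim/mpoly_add_ind: p => [|m2|p q Hp Hq]; last first.
- by rewrite sqrpD mulrDr !mcoeffD Hp Hq mulrDr.
- rewrite mpolyXn -mpolyXD !mcoeffX -natrM mulnb; congr ((nat_of_bool _)%:R).
  apply/eqP/andP => [e|[/eqP-> /eqP->//]].
  have h i : (m1 i + 2 * m2 i = (i \in O) + 2 * m i)%N.
    by rewrite -msqE -e mnmDE mulmnE mulnC.
  have le_O i : ((i \in O) <= m1 i)%N by have := h i; case: (_ \in _); lia.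
  have E : m1 = ind O.
    apply/mnmP => i; rewrite mnmE; apply/eqP.
    have s0 : (\sum_i (m1 i - (i \in O)) == 0)%N.
      rewrite sumnB // -mdegE subn_eq0 dm1 (leq_trans dO) // -mdeg_ind mdegE.
      by apply: leq_sum => j _; rewrite mnmE.
    move: s0; rewrite sum_nat_eq0 => /forallP /(_ i) /=; have := le_O i; lia.
  split; first by rewrite E.
  by apply/eqP/mnmP => i; have := h i; rewrite E mnmE; lia.
- by rewrite expr0n mulr0 !mcoeff0 mulr0.
Qed.

Lemma mcoeff_mul_sqr0 u p d O m : u \is d.-homog -> (d < #|O|)%N ->
  (u * p ^+ 2)@_(msq O m) = 0.
Proof.
move=> hu dO; rewrite (mcoeff_mul_sqr _ _ hu) 1?ltnW //.
by rewrite (dhomog_nemf_coeff hu) ?mul0r //= mdeg_ind neq_ltn dO orbT.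
Qed.

Definition lin l := forall i, l i \is 1.-homog.

Lemma homogXU i : ('X_i : P) \is 1.-homog.
Proof. by rewrite dhomogX /= mdeg1. Qed.

Lemma Sq_lin p : p \is 1.-homog -> Sq p = p + p ^+ 2.
Proof.
move=> /dhomogP hp; rewrite [p]mpolyE Sq_sum sqrp_sum -big_split /=.
rewrite !big_seq; apply: eq_bigr => m pm; have := pm.
rewrite mcoeff_msupp => /F2_neq0 ->; rewrite scale1r.
by have /eqP /mdeg1P[i /eqP ->] := hp m pm; rewrite SqXU.
Qed.

Lemma prod_homog (I : Type) (s : seq I) (Q : pred I) (F : I -> P) (D : I -> nat) :
  (forall x, Q x -> F x \is (D x).-homog) ->
  \prod_(x <- s | Q x) F x \is (\sum_(x <- s | Q x) D x).-homog.
Proof.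
move=> h; apply: (big_rec2 (fun (d : nat) p => p \is d.-homog)); first exact: dhomog1.
by move=> x d p Qx hp; apply: dhomogM => //; apply: h.
Qed.

Lemma subst_homog l d p : lin l -> p \is d.-homog -> subst l p \is d.-homog.
Proof.
move=> hl /dhomogP hp; rewrite [p]mpolyE subst_sum big_seq rpred_sum // => m pm.
have := pm; rewrite mcoeff_msupp => /F2_neq0 ->; rewrite scale1r.
rewrite substX -(hp m pm) /= mdegE.
apply: prod_homog => i _; rewrite -[X in X.-homog]mul1n; exact: dhomogMn.
Qed.

(** Both sides are ring morphisms in [p], and they agree on variables because Sq sends a linear form
    h to h + h^2. *)
Lemma subst_Sq l p : lin l -> subst l (Sq p) = Sq (subst l p).
Proof.
move=> hl; elim/mpoly_ring_ind: p => [||i|p q|p q].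
- by rewrite ?Sq0 !subst0 ?Sq0.
- by rewrite ?Sq1 !subst1 ?Sq1.
- by rewrite substXU (Sq_lin (hl i)) SqXU substD substXn substXU.
- by move=> hp hq; rewrite (SqD p q) (substD l p q) (SqD (subst l p)) -hp -hq substD.
- by move=> hp hq; rewrite (SqM p q) (substM l p q) (SqM (subst l p)) -hp -hq substM.
Qed.

Lemma subst_comp l1 l2 p :
  subst l2 (subst l1 p) = subst (fun i => subst l2 (l1 i)) p.
Proof.
elim/mpoly_ring_ind: p => [||i|p q|p q].
- by rewrite ?Sq0 !subst0 ?Sq0.
- by rewrite ?Sq1 !subst1 ?Sq1.
- by rewrite !substXU.
- by move=> hp hq; rewrite (substD l1 p) (substD _ p q) -hp -hq substD.
- by move=> hp hq; rewrite (substM l1 p) (substM _ p q) -hp -hq substM.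
Qed.

Lemma subst_xs l B : subst l (xs B) = \prod_(i in B) l i.
Proof. by rewrite subst_prod; apply: eq_bigr => i _; rewrite substXU. Qed.

Lemma subst_xs_id l B : {in B, forall i, l i = 'X_i} -> subst l (xs B) = xs B.
Proof. by move=> h; rewrite subst_xs; apply: eq_bigr. Qed.

Definition spike m := forall i, exists s, m i = (2 ^ s - 1)%N.

(** If a monomial x^a other than x^m contributed to x^m in its total square, some a_i would be
    smaller than m_i = 2^s - 1, and then its binomial factor is even by [odd_bin_spike]. *)
Lemma spike_Sq m p : spike m -> (Sq p)@_m = p@_m.
Proof.
move=> sm; elim/mpoly_add_ind: p => [|a|p q hp hq]; first by rewrite Sq0.
  rewrite mcoeff_SqX mcoeffX; case: eqP => [->|am].
    by rewrite big1 // => i _; rewrite leqnn subnn bin0.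
  have [/forallP e|] := boolP [forall i, a i == m i].
    by case: am; apply/mnmP => i; apply/eqP.
  rewrite negb_forall => /existsP[i ne]; rewrite (bigD1 i) //=.
  have [le_am|] := leqP (a i) (m i); last by rewrite mul0n mul0r.
  rewrite mul1n; have [s ms] := sm i.
  have lt_am : (a i < 2 ^ s - 1)%N by rewrite -ms ltn_neqAle ne.
  have := odd_bin_spike lt_am; rewrite -ms; move: ('C(_, _)) => c oc.
  have -> : (c%:R : 'F_2) = 0.
    by apply/eqP; rewrite -(dvdn_pcharf (pchar_Fp (isT : prime 2))) dvdn2.
  by rewrite mul0r.
by rewrite SqD !mcoeffD hp hq.
Qed.

Lemma KK_spike m : spike m -> KK (mdeg m) (fun p : P => p@_m).
Proof.
move=> sm; split=> [p q|p|m' mm']; rewrite ?mcoeffD ?spike_Sq //.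
by rewrite mcoeffX; case: (m' =P m) mm' => // ->; rewrite eqxx.
Qed.

Lemma KK_subst l n f : lin l -> KK n f -> KK n (fun p => f (subst l p)).
Proof.
move=> hl Kf; split=> [p q|p|m mn]; first by rewrite substD (KKD Kf).
  by rewrite subst_Sq // (KKS Kf).
by apply: (KK_homog (d := mdeg m) Kf) => //; apply: subst_homog; rewrite ?dhomogX.
Qed.

Fixpoint W (w : seq 'I_k) (y : P) : P :=
  if w is i :: w' then xs [set~ i] * W w' y ^+ 2 else y.

Lemma W_cat w1 w2 y : W (w1 ++ w2) y = W w1 (W w2 y).
Proof. by elim: w1 => //= i w ->. Qed.

(** The exponents of X_i0 (x^m)^2, the effect on a monomial of one letter [i0] of a word. *)
Definition mlift (i0 : 'I_k) m := msq [set~ i0] m.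

Lemma cardsC1' i : #|[set~ i]| = k.-1.
Proof. by rewrite cardsC1 card_ord. Qed.

(** One letter is removed at a time: X_i and the odd part of the target both have degree k - 1, so
    [mcoeff_mul_sqr] factors the coefficient. *)
Lemma mcoeff_subst_W l i0 w y m : lin l ->
  (subst l (W w y))@_(iter (size w) (mlift i0) m) =
  (\prod_(i <- w) (subst l (xs [set~ i]))@_(ind [set~ i0])) * (subst l y)@_m.
Proof.
move=> hl; elim: w => [|i w IH]; first by rewrite big_nil mul1r.
rewrite big_cons /= substM substXn.
rewrite (@mcoeff_mul_sqr _ _ (k.-1)%N) ?cardsC1' //; first by rewrite IH mulrA.
by apply: subst_homog => //; rewrite -(cardsC1' i) xs_homog.
Qed.

Lemma mcoeff_subst_sqr0 l u p d O m : lin l -> u \is d.-homog -> (d < #|O|)%N ->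
  (subst l (u * p ^+ 2))@_(msq O m) = 0.
Proof.
move=> hl hu dO; rewrite substM substXn (@mcoeff_mul_sqr0 _ _ (d)%N) //.
exact: subst_homog.
Qed.

(** The polynomial is x_t^2 times fewer than [#|O|] variables, and a linear substitution preserves
    this shape, so no squarefree monomial on [O] can appear. *)
Lemma mcoeff_subst_dup l t B O : lin l -> t \in B -> (#|B| <= #|O|)%N ->
  (subst l ('X_t * xs B))@_(ind O) = 0.
Proof.
move=> hl tB BO; rewrite (xsD1 tB) mulrA -expr2 mulrC -msq0.
apply: (@mcoeff_subst_sqr0 _ _ _ #|B :\ t|) => //; first exact: xs_homog.
by rewrite (cardsD1 t B) tB in BO.
Qed.

End Substitutions.

(** * The family of spike functionals *)

Section Family.
Variable r : nat.
Hypothesis r2 : (2 <= r)%N.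
Local Notation k := r.+1.
Local Notation P := {mpoly 'F_2[k]}.
Implicit Types (p q u z y : P) (m : 'X_{1..k}) (i a b : 'I_k) (B O T S E : {set 'I_k}).

(** The pivot of [T], whose variable [ell T] eliminates; the default [ord0] only concerns the empty
    set. *)
Definition pv T : 'I_k := odflt ord0 [pick i in T].

Lemma pvP T : T != set0 -> pv T \in T.
Proof.
rewrite /pv; case: pickP => //= T0 /set0Pn[i iT].
by rewrite (T0 i) in iT.
Qed.

Definition hs T : P := \sum_(t in T) 'X_t.

(** For [i0] in [T] this is reduction modulo the linear form [hs T], the characteristic being 2. *)
Definition ell T (i0 i : 'I_k) : P := if i == i0 then hs (T :\ i0) else 'X_i.

Definition shear a b i : P := if i == b then 'X_a + 'X_b else 'X_i.

(* [Some (E, a)] with [#|E| = 2] stands for the functional on [P_(k-1)] (the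
   variables other than [x_i0]) reading off the spike
   [x_a^3 * prod_(i notin a, b, E) x_i], after the shear [x_b -> x_a + x_b] when
   [i0 \in E]; [None] stands for the spike [prod_(i != i0) x_i]. *)
Definition tau := option ({set 'I_k} * 'I_k).

(** Chosen so that [bb i0 E |: E], the set of variables missing from the spike, always has three
    elements and contains [i0]. If [i0] is not in [E], the shear only moves x_i0, which does not
    occur after [ell]. *)
Definition bb (i0 : 'I_k) E := if i0 \in E then pv (~: E) else i0.

Definition valid (i0 : 'I_k) (t : tau) : bool :=
  if t is Some (E, a) then (#|E| == 2) && (a \notin bb i0 E |: E) else true.

Definition sh (i0 : 'I_k) (t : tau) : 'I_k -> P :=
  if t is Some (E, a) then shear a (bb i0 E) else fun i => 'X_i.

Definition mtau (i0 : 'I_k) (t : tau) : 'X_{1..k} :=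
  if t is Some (E, a) then msq (~: (bb i0 E |: E)) U_(a) else ind [set~ i0].

(** For [i0] outside [E] this is the spike [mtau] itself. For [i0] in [E] the exponent of x_a is 2
    and x_b occurs, with [b = bb i0 E]; the shear x_b -> x_a + x_b then creates the spike with
    x_a^3. *)
Definition ytau (i0 : 'I_k) (t : tau) : P :=
  if t is Some (E, a)
  then xs (~: ((if i0 \in E then a else i0) |: E)) * 'X_a ^+ 2
  else xs [set~ i0].

Definition ktau (i0 : 'I_k) (t : tau) : nat :=
  if t is Some (E, a) then i0 \in E else false.

Definition LL T (t : tau) i : P := subst (sh (pv T) t) (ell T (pv T) i).

Definition phi d (x : {set 'I_k} * tau) p : 'F_2 :=
  (subst (LL x.1 x.2) p)@_(iter d (mlift (pv x.1)) (mtau (pv x.1) x.2)).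

Lemma bbP (i0 : 'I_k) E : #|E| = 2 -> bb i0 E \notin E.
Proof.
move=> E2; rewrite /bb; case: ifPn => // _; rewrite -in_setC pvP //.
by rewrite -card_gt0 cardsCs setCK card_ord E2; lia.
Qed.

Lemma bb_in (i0 : 'I_k) E : i0 \in bb i0 E |: E.
Proof. by rewrite /bb; case: ifPn => iE; rewrite !inE ?eqxx ?iE ?orbT. Qed.

Lemma cardZ (i0 : 'I_k) E : #|E| = 2 -> #|bb i0 E |: E| = 3.
Proof. by move=> E2; rewrite cardsU1 bbP // E2. Qed.

Lemma hs_homog T : hs T \is 1.-homog.
Proof. by rewrite /hs rpred_sum // => i _; apply: homogXU. Qed.

Lemma lin_ell T (i0 : 'I_k) : lin (ell T i0).
Proof. by move=> i; rewrite /ell; case: ifP => _; rewrite ?hs_homog ?homogXU. Qed.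

Lemma lin_sh (i0 : 'I_k) t : lin (sh i0 t).
Proof.
case: t => [[E a]|] i /=; rewrite ?homogXU // /shear.
by case: ifP => _; rewrite ?homogXU // rpredD ?homogXU.
Qed.

Lemma lin_LL T t : lin (LL T t).
Proof. by move=> i; apply/subst_homog/lin_ell/lin_sh. Qed.

Lemma subst_LL T t p : subst (LL T t) p = subst (sh (pv T) t) (subst (ell T (pv T)) p).
Proof. by rewrite subst_comp. Qed.

Lemma subst_hs (l : 'I_k -> P) T : subst l (hs T) = \sum_(t in T) l t.
Proof. by rewrite subst_sum; apply: eq_bigr => i _; rewrite substXU. Qed.

Lemma hsD1 T i : i \in T -> hs T = 'X_i + hs (T :\ i).
Proof. by move=> iT; rewrite /hs (big_setD1 i). Qed.

Lemma ell_hs T (i0 : 'I_k) : i0 \in T -> subst (ell T i0) (hs T) = 0.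
Proof.
move=> i0T; rewrite subst_hs (big_setD1 i0) //= {1}/ell eqxx.
rewrite [X in _ + X](_ : _ = hs (T :\ i0)) ?addpp //.
by apply: eq_bigr => t; rewrite !inE /ell => /andP[/negPf->].
Qed.

Lemma LL_hs T t : T != set0 -> subst (LL T t) (hs T) = 0.
Proof. by move=> T0; rewrite subst_LL ell_hs ?subst0 // pvP. Qed.

Lemma cardC3 (i j h : 'I_k) : i != j -> i != h -> j != h ->
  #|~: [set i; j; h]| = (k - 3)%N.
Proof.
move=> ij ih jh; rewrite cardsCs setCK card_ord setUC cardsU1 !inE.
by rewrite cards2 eq_sym (negPf ih) eq_sym (negPf jh) ij.
Qed.

Lemma sh_xs0 (i0 : 'I_k) t : valid i0 t ->
  (subst (sh i0 t) (xs [set~ i0]))@_(ind [set~ i0]) = 1.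
Proof.
case: t => [[E a]|] /=; last first.
  by rewrite subst_xs_id // xsE mcoeffX eqxx.
case/andP=> /eqP E2 aZ; set b := bb i0 E in aZ *.
have [bi0|bi0] := eqVneq b i0.
  rewrite subst_xs_id ?xsE ?mcoeffX ?eqxx // => i; rewrite !inE /shear => ii0.
  by rewrite bi0 (negPf ii0).
have ab : a != b by apply: contraNneq aZ => ->; rewrite setU11.
have ai0 : a != i0 by apply: contraNneq aZ => ->; apply: bb_in.
rewrite (@xsD1 _ _ b) ?inE // substM substXU {1}/shear eqxx.
rewrite subst_xs_id => [|i]; last by rewrite !inE /shear => /andP[/negPf->].
rewrite mulrDl mcoeffD -xsD1 ?inE // [xs [set~ i0]]xsE mcoeffX eqxx.
rewrite (@xsD1 _ _ a) ?inE ?ab // mulrA -expr2 mulrC -msq0.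
rewrite (@mcoeff_mul_sqr0 _ _ _ (r - 2)%N) ?add0r //; last first.
  by rewrite cardsC1 card_ord /=; lia.
rewrite (_ : (r - 2)%N = #|[set~ i0] :\ b :\ a|) ?xs_homog //.
have := cardsD1 b [set~ i0]; have := cardsD1 a ([set~ i0] :\ b).
by rewrite !inE ab ai0 bi0 cardsC1 card_ord /=; lia.
Qed.

(** For [i] other than the pivot, [ell] replaces the pivot variable in X_i by the sum of the other
    x_j with j in [T]. The summand j = i gives X of the pivot, and every other one repeats a
    variable and contributes nothing. *)
Lemma LL_xs T t i : T != set0 -> valid (pv T) t ->
  (subst (LL T t) (xs [set~ i]))@_(ind [set~ (pv T)]) = (i \in T)%:R.
Proof.
move=> T0 vt; set i0 := pv T in vt *; have i0T : i0 \in T := pvP T0.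
have ellid B : i0 \notin B -> subst (ell T i0) (xs B) = xs B.
  move=> i0B; apply: subst_xs_id => j jB; rewrite /ell.
  by case: eqP => // ji; rewrite -ji jB in i0B.
rewrite subst_LL -/i0; have [->|ii0] := eqVneq i i0.
  by rewrite ellid ?inE ?eqxx // sh_xs0 // i0T.
rewrite (@xsD1 _ _ i0) ?inE 1?eq_sym // substM substXU {1}/ell eqxx.
rewrite ellid ?inE ?eqxx // /hs mulr_suml subst_sum linear_sum /=.
have C2 : #|[set~ i] :\ i0| = r.-1.
  have := cardsD1 i0 [set~ i].
  by rewrite !inE [_ == i]eq_sym ii0 cardsC1 card_ord /=; lia.
have E j : j \in T :\ i0 -> (subst (sh i0 t) ('X_j * xs ([set~ i] :\ i0)))@_(ind [set~ i0])
    = (j == i)%:R.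
  rewrite !inE => /andP[ji0 jT]; case: eqP => [->|/eqP ji].
    rewrite xsU1 ?inE ?eqxx ?andbF // (_ : i |: _ = [set~ i0]) ?sh_xs0 //.
    by apply/setP => h; rewrite !inE; case: eqP => [->|] //=; rewrite ?andbT.
  apply: mcoeff_subst_dup; rewrite ?inE ?ji ?ji0 //; first exact: lin_sh.
  by rewrite cardsC1 card_ord C2 /=; lia.
rewrite (eq_bigr _ E); have [iT|iT] := boolP (i \in T).
  by rewrite (big_setD1 i) ?inE ?ii0 //= eqxx big1 ?addr0 // => j; rewrite !inE => /andP[/negPf->].
rewrite big1 // => j; rewrite !inE => /andP[_ jT]; case: eqP => // ji.
by rewrite -ji jT in iT.
Qed.

Lemma mcoeff_LL_W d T t w y m : T != set0 -> valid (pv T) t -> size w = d ->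
  (subst (LL T t) (W w y))@_(iter d (mlift (pv T)) m) =
  (all (mem T) w)%:R * (subst (LL T t) y)@_m.
Proof.
move=> T0 vt <-; rewrite mcoeff_subst_W; last exact: lin_LL.
congr (_ * _); elim: w => [|i w IH]; first by rewrite big_nil.
by rewrite big_cons IH LL_xs //= -natrM mulnb.
Qed.

Lemma mlift_iter0 (i0 : 'I_k) d m : m i0 = 0%N -> iter d (mlift i0) m i0 = 0%N.
Proof.
by move=> m0; elim: d => //= d IH; rewrite msqE IH !inE eqxx.
Qed.

Lemma spike_iter (i0 : 'I_k) d m : m i0 = 0%N -> spike m -> spike (iter d (mlift i0) m).
Proof.
move=> m0 sm; elim: d => //= d IH i; rewrite msqE !inE.
have [->|ii0] := eqVneq i i0; first by exists 0; rewrite mlift_iter0.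
have [s ->] := IH i; exists s.+1; rewrite expnS /=.
by have := expn_gt0 2 s; lia.
Qed.

Lemma mdeg_iter (i0 : 'I_k) d e m : mdeg m = (r * (2 ^ e - 1))%N ->
  mdeg (iter d (mlift i0) m) = (r * (2 ^ (d + e) - 1))%N.
Proof.
move=> me; elim: d => //= d IH; rewrite mdeg_msq cardsC1 card_ord IH addSn expnS /=.
by have := expn_gt0 2 (d + e); case: (2 ^ _)%N => // c _; rewrite !subn1 /=; nia.
Qed.

Lemma mtau0 (i0 : 'I_k) t : valid i0 t -> mtau i0 t i0 = 0%N.
Proof.
case: t => [[E a]|] /=; last by rewrite mnmE !inE eqxx.
case/andP=> _ aZ; rewrite msqE inE bb_in /= mnm1E.
by case: eqP => // ai; rewrite ai bb_in in aZ.
Qed.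

Lemma spike_sq1 O a : a \in O -> spike (msq O U_(a)).
Proof.
move=> aO i; rewrite msqE mnm1E; have [<-|_] := eqVneq a i.
  by exists 2; rewrite aO.
by exists (i \in O); case: (i \in O).
Qed.

Lemma spike_mtau (i0 : 'I_k) t : valid i0 t -> spike (mtau i0 t).
Proof.
case: t => [[E a]|] /=; last by move=> _ i; rewrite mnmE; exists (i \in [set~ i0]); case: (_ \in _).
by case/andP=> _ aZ; apply: spike_sq1; rewrite in_setC.
Qed.

Lemma mdeg_mtau (i0 : 'I_k) t : valid i0 t -> mdeg (mtau i0 t) = r.
Proof.
case: t => [[E a]|] /=; last by rewrite mdeg_ind cardsC1 card_ord.
case/andP=> /eqP E2 aZ; rewrite mdeg_msq cardsCs setCK card_ord cardZ // mdeg1; lia.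
Qed.

(** The parameter [e] is 1 for the family [phi], and 2 for the additional functional used when k >=
    6. *)
Lemma KK_LL_spike T t d e m : m (pv T) = 0%N -> spike m -> mdeg m = (r * (2 ^ e - 1))%N ->
  KK (r * (2 ^ (d + e) - 1)) (fun p => (subst (LL T t) p)@_(iter d (mlift (pv T)) m)).
Proof.
move=> m0 sm me; apply: (KK_subst (f := fun p => p@_(iter d (mlift (pv T)) m))).
  exact: lin_LL.
by rewrite -(mdeg_iter (pv T) d me); apply/KK_spike/spike_iter.
Qed.

Lemma KK_phi d x : valid (pv x.1) x.2 -> KK (r * (2 ^ d.+1 - 1)) (phi d x).
Proof.
move=> vx; rewrite -(addn1 d); apply: KK_LL_spike; first exact: mtau0.
  exact: spike_mtau.
by rewrite mdeg_mtau // muln1.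
Qed.

End Family.

(** * Test polynomials and unitriangularity *)

Section Tests.
Variable r : nat.
Hypothesis r2 : (2 <= r)%N.
Local Notation k := r.+1.
Local Notation P := {mpoly 'F_2[k]}.
Implicit Types (p q u z y : P) (m : 'X_{1..k}) (i a b : 'I_k) (B O T S E : {set 'I_k}).

Lemma subst_id p : subst (fun i => 'X_i) p = p.
Proof.
elim/mpoly_ring_ind: p => [||i|p q hp hq|p q hp hq].
- by rewrite subst0.
- by rewrite subst1.
- by rewrite substXU.
- by rewrite substD hp hq.
- by rewrite substM hp hq.
Qed.

Definition ctau (i0 : 'I_k) E a : {set 'I_k} := (if i0 \in E then a else i0) |: E.

Lemma ytau_Some (i0 : 'I_k) E a : ytau i0 (Some (E, a)) = 'X_[msq (~: ctau (i0 : 'I_k) E a) U_(a)].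
Proof. by rewrite mpolyX_msq. Qed.

Lemma ctau_in (i0 : 'I_k) E a : i0 \in ctau (i0 : 'I_k) E a.
Proof. by rewrite /ctau; case: ifP => iE; rewrite !inE ?eqxx ?iE ?orbT. Qed.

Lemma valid_neq (i0 : 'I_k) E a : valid i0 (Some (E, a)) -> a != i0.
Proof. by case/andP=> _; apply: contraNneq => ->; apply: bb_in. Qed.

(** The variable x_i0 does not occur in [ytau]. *)
Lemma ytau_fix (l : 'I_k -> P) (i0 : 'I_k) t : valid i0 t ->
  (forall i, i != i0 -> l i = 'X_i) -> subst l (ytau i0 t) = ytau i0 t.
Proof.
move=> vt hl; case: t vt => [[E a]|] vt /=; last first.
  by apply: subst_xs_id => i; rewrite !inE; apply: hl.
rewrite substM substXn substXU hl ?(valid_neq vt) // subst_xs_id // => i.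
rewrite inE -/(ctau i0 E a) => ic; apply: hl.
by apply: contraNneq ic => ->; apply: ctau_in.
Qed.

Lemma ytau_mcoeff (i0 : 'I_k) t t' : valid i0 t -> valid i0 t' -> ktau i0 t' = 0%N ->
  (ytau i0 t)@_(mtau i0 t') = (t == t')%:R.
Proof.
case: t' => [[E' a']|]; case: t => [[E a]|] vt vt' kt'; rewrite ?ytau_Some /=.
- rewrite mcoeffX; congr ((nat_of_bool _)%:R); apply/eqP/eqP => [/msq_inj[e1 e2]|].
    have aa : a = a' by apply/eqP; rewrite -eq_mnm1 e2.
    congr (Some (_, _)) => //; have /setP e := congr1 (@setC _) e1.
    have iE' : i0 \in E' = false by move: kt' => /=; case: (_ \in _).
    move: vt vt'; rewrite /= /bb iE' => /andP[/eqP E2 aZ] /andP[/eqP E2' aZ'].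
    have iE : i0 \notin E.
      apply/negP => iE; have := e a; rewrite !setCK /ctau /bb iE iE' setU11 aa.
      by rewrite (negPf aZ').
    apply/setP => h; have := e h; rewrite !setCK /ctau /bb (negPf iE) iE' !inE.
    by have [->|_] := eqVneq h i0; rewrite ?(negPf iE) ?iE'.
  case=> -> ->; rewrite /ctau /bb; case: ifP => // iE'.
  by move: kt'; rewrite /= iE'.
- rewrite xsE mcoeffX -msq0; case: eqP => // /msq_inj[_ e].
  by have /eqP := e; rewrite eq_sym mnm1_eq0.
- rewrite mcoeffX -msq0; case: eqP => // /msq_inj[_ e].
  by have /eqP := e; rewrite mnm1_eq0.
- by rewrite xsE mcoeffX !eqxx.
Qed.

Lemma tau_mcoeff0 (i0 : 'I_k) t t' : valid i0 t -> valid i0 t' -> ktau i0 t' = 0%N ->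
  (subst (sh i0 t') (ytau i0 t))@_(mtau i0 t') = (t == t')%:R.
Proof.
move=> vt vt' kt'; rewrite ytau_fix ?ytau_mcoeff // => i ii0.
case: t' vt' kt' => [[E' a']|] //= _; rewrite /shear /bb.
by case: (i0 \in E') => // _; rewrite (negPf ii0).
Qed.

(** The coefficient is a squarefree part times the coefficient of x_a' in the sheared x_a, so [a] is
    b' or a'. The case a = b' would force E = E' and [a = bb i0 E], against validity. If a = a', the
    target contains [a] and [Z] does not, so only the summand x_a of the sheared x_b' can
    contribute, and it matches exactly when E = E'. *)
Lemma shear_mcoeff (i0 : 'I_k) E a E' a' : i0 \in E -> i0 \in E' ->
  valid i0 (Some (E, a)) -> valid i0 (Some (E', a')) ->
  (subst (shear a' (bb i0 E')) (ytau i0 (Some (E, a))))@_(mtau i0 (Some (E', a')))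
  = ((E, a) == (E', a'))%:R.
Proof.
move=> iE iE' /andP[/eqP E2 aZ] /andP[/eqP E2' aZ']; rewrite /= iE.
set b := bb i0 E in aZ; set b' := bb i0 E' in aZ' *; set Z := ~: (a |: E).
have bE : b \notin E := bbP r2 i0 E2; have bE' : b' \notin E' := bbP r2 i0 E2'.
move: aZ aZ'; rewrite !inE !negb_or => /andP[ab aE] /andP[ab' aE'].
have Zc : #|Z| = (k - 3)%N by rewrite cardsCs setCK card_ord cardsU1 aE E2.
have hl : lin (shear a' b') := lin_sh i0 (Some (E', a')).
rewrite substM substXn (@mcoeff_mul_sqr _ _ _ (k - 3)%N); first last.
- by rewrite cardsCs setCK card_ord cardsU1 bE' E2'.
- by apply: subst_homog; rewrite // -Zc xs_homog.
have fixZ B : b' \notin B -> subst (shear a' b') (xs B) = xs B.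
  move=> bB; apply: subst_xs_id => h hB; rewrite /shear.
  by case: eqP => // hb; rewrite -hb hB in bB.
rewrite substXU {2}/shear; have [ea|nab'] := eqVneq a b'.
  have bZ : b' \notin Z by rewrite !inE ea eqxx.
  rewrite fixZ // xsE mcoeffX; case: (ind Z =P _) => [/ind_inj|]; last first.
    rewrite mul0r; case: eqP => // -[eE ea'].
    by rewrite -ea' ea eqxx in ab'.
  move/(congr1 (@setC _)); rewrite !setCK => /setP e.
  have EE : E = E'.
    apply/setP => h; have := e h; rewrite !inE ea.
    by have [->|_] := eqVneq h b'; rewrite ?(negPf bE') -?ea ?(negPf aE).
  by rewrite /b EE -/b' ea eqxx in ab.
rewrite mcoeffXU; have [ea|na] := eqVneq a a'; last first.
  by rewrite mulr0; case: eqP => // -[_ ea]; rewrite ea eqxx in na.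
rewrite mulr1 -ea; have [bZ|bZ] := boolP (b' \in Z); last first.
  rewrite -ea in fixZ *; rewrite fixZ // xsE mcoeffX.
  case: (ind Z =P _) => [/ind_inj/setP/(_ a)|_].
    by rewrite !inE eqxx (negPf aE) ea (negPf ab') (negPf aE').
  case: eqP => // -[EE]; case/negP: bZ.
  by rewrite !inE negb_or eq_sym nab' EE.
rewrite (xsD1 bZ) substM substXU ea {1}/shear eqxx fixZ ?inE ?eqxx //.
rewrite mulrDl -xsD1 // xsU1; last by rewrite !inE ea eqxx andbF.
rewrite mcoeffD !xsE !mcoeffX.
have -> : (ind Z == ind (~: (b' |: E'))) = false.
  apply/eqP => /ind_inj/setP/(_ a).
  by rewrite !inE eqxx (negPf aE) ea (negPf ab') (negPf aE').
rewrite addr0; congr ((nat_of_bool _)%:R); rewrite -ea.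
move: (bZ); rewrite !inE negb_or => /andP[nb'a b'E].
apply/eqP/eqP => [/ind_inj/setP e|[EE]].
  congr (_, _); apply/setP => h; have := e h; rewrite !inE !negb_or.
  have [->|ha] := eqVneq h a; first by rewrite (negPf aE) ea (negPf aE').
  have [->|hb] := eqVneq h b'; first by rewrite (negPf b'E) (negPf bE').
  by rewrite /=; do 2!case: (h \in _).
congr ind; apply/setP => h; rewrite !inE !negb_or -EE.
have [->|ha] := eqVneq h a; first by rewrite nab' (negPf aE).
by rewrite /=; case: eqP.
Qed.

Lemma tau_diag (i0 : 'I_k) t : valid i0 t -> (subst (sh i0 t) (ytau i0 t))@_(mtau i0 t) = 1.
Proof.
move=> vt; have [k0|] := eqVneq (ktau i0 t) 0%N; first by rewrite tau_mcoeff0 ?eqxx.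
case: t vt => [[E a]|] //= vt; case iE: (i0 \in E) => // _.
by have := shear_mcoeff iE iE vt vt; rewrite eqxx /= iE.
Qed.

Lemma tau_tri (i0 : 'I_k) t t' : valid i0 t -> valid i0 t' ->
  (subst (sh i0 t') (ytau i0 t))@_(mtau i0 t') != 0 -> t' != t ->
  (ktau i0 t < ktau i0 t')%N.
Proof.
move=> vt vt'; have [k0|] := eqVneq (ktau i0 t') 0%N.
  by rewrite tau_mcoeff0 // [t' == t]eq_sym; case: (t =P t'); rewrite ?eqxx.
case: t' vt' => [[E' a']|] // vt'; rewrite {1}/ktau; case iE': (i0 \in E') => // _.
case: t vt => [[E a]|] vt; rewrite /ktau iE' //; case iE: (i0 \in E) => //.
rewrite [sh _ _]/= shear_mcoeff // eq_sym => h; case/negP.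
by move: h; case: ((E, a) =P _) => [->|]; rewrite eqxx.
Qed.

(** For [#|T| <= d], a word of length [d] with letters exactly [T]. Which letter pads it is
    immaterial, since [W_support] shows that only the support matters. *)
Definition wd d T := enum T ++ nseq (d - #|T|) (pv T).

Lemma size_wd d T : (#|T| <= d)%N -> size (wd d T) = d.
Proof. by move=> Td; rewrite size_cat size_nseq -cardE subnKC. Qed.

Lemma all_enum_sub T S : all (mem S) (enum T) = (T \subset S).
Proof.
apply/allP/subsetP => h i; last by rewrite mem_enum; apply: h.
by move=> iT; apply: h; rewrite mem_enum.
Qed.

Lemma all_wd d T S : T != set0 -> all (mem S) (wd d T) = (T \subset S).
Proof.
move=> T0; rewrite all_cat all_enum_sub all_nseq andb_idr //.
by move/subsetP => h; rewrite [mem _ _]h ?orbT ?pvP.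
Qed.

(* For [#|T| = d.+1] the word [enum S] with [S = T :\ pv T] and the factor
   [hs S], which vanishes under the substitution [LL S], detect [T] alone. *)
Definition test d (x : {set 'I_k} * tau r) : P :=
  let: (T, t) := x in
  let c := pv T in
  let S := T :\ c in
  if (#|T| <= d)%N then W (wd d T) (ytau c t)
  else if S == set0 then xs [set~ c]
  else W (enum S) (hs S * xs (~: [set pv S; c])).

(** Sets with [d.+1] elements come only with [None], which is why the two sums in [cKD k d.+1] stop
    at different bounds. *)
Definition idx d (x : {set 'I_k} * tau r) : bool :=
  let: (T, t) := x in
  [&& T != set0, valid (pv T) t & (#|T| <= d)%N || (#|T| == d.+1) && (t == None)].

Definition key (x : {set 'I_k} * tau r) : nat :=
  let: (T, t) := x in (2 * #|T| + ktau (pv T) t)%N.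

Lemma phi_W d T t w y : T != set0 -> valid (pv T) t -> size w = d ->
  phi d (T, t) (W w y) =
  (all (mem T) w)%:R * (subst (LL T t) y)@_(mtau (pv T) t).
Proof. by move=> T0 vt wd; apply: mcoeff_LL_W. Qed.

Lemma LL_fix T t t' : T != set0 -> valid (pv T) t ->
  subst (LL T t') (ytau (pv T) t) = subst (sh (pv T) t') (ytau (pv T) t).
Proof.
move=> T0 vt; rewrite subst_LL ytau_fix // => i ii.
by rewrite /ell (negPf ii).
Qed.

Lemma setU1_sub_card T S : S \subset T -> #|T| = #|S|.+1 ->
  exists2 e, e \in T :\: S & T = e |: S.
Proof.
move=> ST c; have : #|T :\: S| == 1%N.
  by rewrite cardsD (setIidPr ST) c subSnn.
case/cards1P => e eD; exists e; first by rewrite eD set11.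
apply/setP => i; have /setP/(_ i) := eD; have := subsetP ST i; rewrite !inE.
by case: (i \in S) => /= [-> //|_ <-]; rewrite ?orbT ?orbF.
Qed.

(** [LL T] kills hs T = x_e + hs S, so x_e and [hs S] have the same image. *)
Lemma LL_hs_mul T t S e z : T != set0 -> T = e |: S -> e \notin S ->
  subst (LL T t) (hs S * z) = subst (LL T t) ('X_e * z).
Proof.
move=> T0 TS eS; rewrite !substM; congr (_ * _).
have := LL_hs t T0; rewrite {2}TS (@hsD1 _ _ e) ?setU11 // setU1K // substD.
by move/eqP; rewrite addr_eq0 oppp => /eqP.
Qed.

(** For nonempty [S] the word forces [S] to lie in T'. If T' = S, the factor [hs S] is killed.
    Otherwise T' = S + e and [hs S] acts as x_e: for e = c this completes X_c, and for any other e
    it repeats a variable of the squarefree factor. *)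
Lemma phi_special d T T' t' : idx d (T, None) -> #|T| = d.+1 -> idx d (T', t') ->
  phi d (T', t') (test d (T, None)) = ((T', t') == (T, None))%:R.
Proof.
case/and3P=> T0 _ _ Td /and3P[T'0 vt' hT'].
rewrite /test Td ltnn; set c := pv T; set S := T :\ c.
have cT : c \in T := pvP T0.
have Sd : #|S| = d by have := cardsD1 c T; rewrite cT Td add1n => -[].
have [S0|S0] := eqVneq S set0.
  have d0 : d = 0%N by rewrite -Sd S0 cards0.
  move: hT'; rewrite d0 leqn0 cards_eq0 (negPf T'0) /= => /andP[/cards1P[e Te] /eqP t0].
  have /eqP/cards1P[e1 Te1] : #|T| = 1%N by rewrite Td d0.
  rewrite /phi /= t0 LL_xs //.
  congr ((nat_of_bool _)%:R); rewrite xpair_eqE eqxx andbT.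
  move: cT; rewrite Te Te1 !inE => /eqP ->.
  by rewrite -(inj_eq set1_inj) eq_sym.
rewrite phi_W // -?cardE // all_enum_sub.
have [ST|] := boolP (S \subset T'); last first.
  rewrite mul0r; case: eqP => // -[-> _]; by rewrite subD1set.
rewrite mul1r.
have [SeT|neS] := eqVneq S T'.
  rewrite substM -{2}SeT {1}SeT; rewrite SeT LL_hs // mul0r mcoeff0.
  case: eqP => // -[eT _]; have := Sd; rewrite SeT eT Td; lia.
have T'd : #|T'| = d.+1.
  have : (#|S| < #|T'|)%N by apply: proper_card; rewrite properEneq neS ST.
  rewrite Sd; case/orP: hT' => [|/andP[/eqP->]//]; lia.
have t0 : t' = None by move: hT'; rewrite T'd ltnn /= => /andP[_ /eqP].
rewrite t0 in vt' *; have [|e eD TS] := setU1_sub_card ST; first by rewrite Sd.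
have eS : e \notin S by move: eD; rewrite inE => /andP[].
have cS : c \notin S by rewrite !inE eqxx.
have pS : pv S \in S := pvP S0.
rewrite (LL_hs_mul None _ T'0 TS eS) xpair_eqE eqxx andbT.
have [ec|ec] := eqVneq e c.
  have TT : T' = T by rewrite TS ec setD1K.
  have pc : pv T' = c by rewrite TT.
  rewrite TT eqxx ec -(LL_hs_mul None _ T0 _ cS) ?setD1K // /mtau -/c.
  rewrite subst_LL -/c substM -[sh c None]/(fun i => 'X_i) subst_id.
  have -> : subst (ell T c) (hs S) = hs S.
    rewrite subst_hs; apply: eq_bigr => h hS; rewrite /ell.
    by case: eqP => // hc; rewrite hc (negPf cS) in hS.
  rewrite subst_xs_id => [|h]; last first.
    by rewrite !inE negb_or /ell => /andP[_ /negPf->].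
  rewrite (hsD1 pS) mulrDl mcoeffD xsU1; last by rewrite !inE eqxx.
  have -> : pv S |: ~: [set pv S; c] = [set~ c].
    apply/setP => h; rewrite !inE; have [->|//] := eqVneq h (pv S).
    by apply/esym; apply: contraNneq cS => <-.
  rewrite {1}xsE mcoeffX eqxx /hs mulr_suml linear_sum /= big1 ?addr0 // => h.
  rewrite !inE => /and3P[hp hc hT]; rewrite -[X in X@__]subst_id.
  apply: mcoeff_subst_dup; first by move=> ?; apply: homogXU.
    by rewrite !inE negb_or hp.
  by rewrite subset_leq_card //; apply/subsetP => g; rewrite !inE negb_or => /andP[].
have -> : (T' == T) = false.
  apply/eqP => TT; move: eD; rewrite TT !inE (negPf ec) /=.
  by case: (e \in T).
apply: mcoeff_subst_dup; first exact: lin_LL.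
  by rewrite !inE negb_or ec andbT; apply: contraNneq eS => ->.
rewrite cardsC1 card_ord /= cardsCs setCK card_ord cards2; lia.
Qed.

Lemma phi_test_diag d x : idx d x -> phi d x (test d x) = 1.
Proof.
case: x => T t ix; have := ix; case/and3P=> T0 vt /orP[Td|/andP[/eqP Td /eqP t0]].
  rewrite /test Td phi_W // ?size_wd // all_wd // subxx mul1r LL_fix //.
  exact: tau_diag.
by rewrite t0 in ix *; rewrite phi_special ?eqxx.
Qed.

Lemma phi_test_tri d x x' : idx d x -> idx d x' -> phi d x (test d x') != 0 ->
  x != x' -> (key x' < key x)%N.
Proof.
case: x => T' t'; case: x' => T t i' i.
have [Td|Td] := leqP #|T| d; last first.
  have := i; case/and3P=> _ _; rewrite leqNgt Td /= => /andP[/eqP c /eqP t0].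
  by rewrite t0 in i *; rewrite phi_special //; case: (_ =P (T, None)) ; rewrite ?eqxx.
case/and3P: i => T0 vt _; case/and3P: i' => T'0 vt' _.
rewrite /test Td phi_W // ?size_wd // all_wd //.
have [TT|_] := boolP (T \subset T'); last by rewrite mul0r eqxx.
rewrite mul1r; have [eT|neT] := eqVneq T T'.
  rewrite -eT in vt' *; rewrite LL_fix // => h; rewrite xpair_eqE eqxx /= => tt.
  by rewrite ltn_add2l; apply: tau_tri.
move=> _ _; have : (#|T| < #|T'|)%N by apply: proper_card; rewrite properEneq neT.
(* Enlarging the set raises [key] by at least 2, more than [ktau] can offset. *)
rewrite /key; case: (t) => [[E a]|] /=; first case: (_ \in _); lia.
Qed.

End Tests.

(** * Counting and the lower bound *)

Lemma card_small_sets k e :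
  #|[set T : {set 'I_k} | (0 < #|T| <= e)%N]| = (\sum_(1 <= t < (minn k e).+1) 'C(k, t))%N.
Proof.
elim: e => [|e IH].
  rewrite minn0 big_geq // (_ : [set _ | _] = set0) ?cards0 //.
  by apply/setP => T; rewrite !inE; case: #|T|.
rewrite (_ : [set _ | _] = [set T : {set 'I_k} | (0 < #|T| <= e)%N] :|:
           [set T : {set 'I_k} | #|T| == e.+1]); last first.
  apply/setP => T; rewrite !inE; lia.
rewrite cardsU (_ : _ :&: _ = set0) ?cards0 ?subn0; last first.
  apply/setP => T; rewrite !inE; lia.
rewrite IH card_draws card_ord; have [le_ke|lt_ek] := leqP k e.
  by rewrite bin_small ?addn0 // (minn_idPl (leqW le_ke)).
by rewrite (minn_idPr lt_ek) [RHS]big_nat_recr.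
Qed.

Lemma exists_notin k (A : {set 'I_k}) : (#|A| < k)%N -> exists i, i \notin A.
Proof.
move=> Ak; have : ~: A != set0 by rewrite -card_gt0 cardsCs setCK card_ord; lia.
by case/set0Pn => i; rewrite inE; exists i.
Qed.

Lemma exists_subset_card (X : finType) (A : {set X}) e : (e <= #|A|)%N ->
  exists2 B : {set X}, B \subset A & #|B| = e.
Proof.
move=> eA; have : (0 < #|[set B : {set X} | (B \subset A) && (#|B| == e)]|)%N.
  by rewrite cards_draws bin_gt0.
by rewrite card_gt0 => /set0Pn[B]; rewrite inE => /andP[? /eqP ?]; exists B.
Qed.

Section LowerBound.
Variable r : nat.
Hypothesis r2 : (2 <= r)%N.
Local Notation k := r.+1.
Local Notation P := {mpoly 'F_2[k]}.
Implicit Types (p q u z y : P) (m : 'X_{1..k}) (i a b : 'I_k) (B O T S E : {set 'I_k}).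

Definition idx1 d : finType := {T : {set 'I_k} | (0 < #|T| <= d.+1)%N}.
Definition idx2 d : finType := {x : {set 'I_k} * ({set 'I_k} * 'I_k) |
  (0 < #|x.1| <= d)%N && valid (pv x.1) (Some x.2)}.
Definition index_type d : finType := (idx1 d + idx2 d)%type.

Definition index_val d (x : index_type d) : {set 'I_k} * tau r :=
  match x with
  | inl T => (val T, None)
  | inr y => ((val y).1, Some (val y).2)
  end.

Lemma index_valP d x : idx d (@index_val d x).
Proof.
case: x => [[T /= /andP[T0 Td]]|[[T t] /= /andP[/andP[T0 Td] vt]]].
  rewrite -card_gt0 T0 /= andbT; lia.
by rewrite -card_gt0 T0 Td /= andbT.
Qed.

Lemma index_val_inj d : injective (@index_val d).
Proof.
move=> [T|x] [T'|x'] //=; first by case=> /val_inj ->.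
by case=> e1 e2; congr inr; apply/val_inj; rewrite [LHS]surjective_pairing e1 e2 -surjective_pairing.
Qed.

(** [E] is any pair, and [a] then avoids the three elements of [bb i E |: E]. *)
Lemma card_valid i : #|[set t : {set 'I_k} * 'I_k | valid i (Some t)]| = ((k - 3) * 'C(k, 2))%N.
Proof.
rewrite -sum1_card (eq_bigl (fun t : {set 'I_k} * 'I_k => (#|t.1| == 2) && (t.2 \notin bb i t.1 |: t.1))).
  rewrite -(pair_big_dep (fun E => #|E| == 2) (fun E a => a \notin bb i E |: E) (fun _ _ => 1%N)) /=.
  rewrite (eq_bigr (fun=> k - 3)%N) => [|E /eqP E2].
    by rewrite sum_nat_const mulnC -[X in 'C(X, _)]card_ord -card_draws cardsE.
  rewrite sum1_card; transitivity #|~: (bb i E |: E)|.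
    by apply: eq_card => a; rewrite [RHS]inE.
  by rewrite cardsCs setCK card_ord cardZ.
by case=> E a; rewrite inE.
Qed.

Lemma card_index d : #|index_type d| = cKD k d.+1.
Proof.
rewrite card_sum !card_sig /cKD -!card_small_sets; congr (_ + _)%N.
  by apply: eq_card => T; rewrite !inE.
transitivity (\sum_(x : {set 'I_k} * ({set 'I_k} * 'I_k) |
    (0 < #|x.1| <= d)%N && valid (pv x.1) (Some x.2)) 1)%N; first by rewrite sum1_card.
rewrite -(pair_big_dep (fun T : {set 'I_k} => (0 < #|T| <= d)%N) (fun T t => valid (pv T) (Some t)) (fun _ _ => 1%N)) /=.
rewrite (eq_bigr (fun=> (k - 3) * 'C(k, 2)))%N => [|T _].
  rewrite sum_nat_const mulnC; congr (_ * _)%N.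
  by apply: eq_card => T; rewrite !inE.
by rewrite -(card_valid (pv T)) -sum1_card; apply: eq_bigl => t; rewrite inE.
Qed.

Lemma cKD_le_dimQP d : (cKD k d.+1 <= dimQP k (r * (2 ^ d.+1 - 1)))%N.
Proof.
rewrite -card_index; apply: (@dimQP_ge _ _ _ (fun x => phi d (index_val x))
  (fun x => test d (index_val x)) (fun x => key (index_val x))).
- move=> x; apply: KK_phi => //.
  by have := index_valP x; case: (index_val x) => T t /and3P[].
- by move=> x; apply: phi_test_diag; rewrite ?index_valP.
- move=> x x' h xx'; apply: (@phi_test_tri _ r2 d); rewrite ?index_valP //.
  by rewrite (inj_eq (@index_val_inj d)).
Qed.

(** All of the family vanishes on [y], so [psi] can be added with a key [K] above all others without
    breaking triangularity. *)
Lemma cKD_lt_dimQP d psi y : KK (r * (2 ^ d.+1 - 1)) psi -> psi y = 1 ->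
  (forall x, idx d x -> phi d x y = 0) ->
  (cKD k d.+1 < dimQP k (r * (2 ^ d.+1 - 1)))%N.
Proof.
move=> Kpsi psiy phiy; rewrite -card_index -card_option.
pose K := (\max_(x : index_type d) key (index_val x)).+1.
apply: (@dimQP_ge _ _ _ (fun x => if x is Some x' then phi d (index_val x') else psi)
  (fun x => if x is Some x' then test d (index_val x') else y)
  (fun x => if x is Some x' then key (index_val x') else K)).
- case=> [x|] //; apply: KK_phi => //.
  by have := index_valP x; case: (index_val x) => T t /and3P[].
- by case=> [x|] //; apply: phi_test_diag; rewrite ?index_valP.
- case=> [x|] [x'|] //; last 1 first.
  + by move=> _ _; rewrite ltnS; apply: (leq_bigmax (F := fun x => key (index_val x))).
  + move=> h xx'; apply: (@phi_test_tri _ r2 d); rewrite ?index_valP //.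
    by rewrite (inj_eq (@index_val_inj d)).
  + by rewrite phiy ?index_valP // eqxx.
Qed.

(** The extra functional reads a spike with x_a^3 for a set [T] of [d.+1] elements, where [idx]
    admits only [None]. The word [enum S] leaves, among indices with [Some], only the set [S], and
    there [hs S] is killed. Indices with [None] read a squarefree monomial of degree r, out of reach
    of k - 3 variables times a square. *)
Lemma cKD_lt_small d : (3 <= r)%N -> (d.+1 <= k)%N ->
  (cKD k d.+1 < dimQP k (r * (2 ^ d.+1 - 1)))%N.
Proof.
move=> r3 dk.
have [T _ Td] : exists2 T : {set 'I_k}, T \subset setT & #|T| = d.+1.
  by apply: exists_subset_card; rewrite cardsT card_ord.
have T0 : T != set0 by rewrite -card_gt0 Td.
set c := pv T; set S := T :\ c; have cT : c \in T := pvP T0.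
have Sd : #|S| = d by have := cardsD1 c T; rewrite cT Td add1n => -[].
have [a ac aS] : exists2 a, a != c & (S != set0 -> a \in S).
  have [S0|S0] := eqVneq S set0.
    have [|a] := @exists_notin k [set c]; first by rewrite cards1; move: r3; clear; lia.
    by rewrite inE; exists a.
  by have /setD1P[pc _] := pvP S0; exists (pv S) => // _; apply: pvP.
(* Here k >= 4 enters: besides [c] and [a], two further variables [e] and [g] are left out of the
   spike. *)
have [|e e_] := @exists_notin k [set c; a]; first by rewrite cards2; move: r3; clear; lia.
have [|g g_] := @exists_notin k [set c; a; e].
  rewrite setUC cardsU1 cards2; move: r3; clear; lia.
move: e_ g_; rewrite !inE !negb_or => /andP[ec ea] /andP[/andP[gc ga] ge].
pose O := ~: [set c; e; g].
have aO : a \in O by rewrite !inE !negb_or ac eq_sym ea eq_sym.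
have cO : c \notin O by rewrite !inE eqxx.
have Oc : #|O| = (k - 3)%N by rewrite cardC3 // eq_sym.
(* For empty [S], that is d = 0, no set has to be killed and x_a alone completes the spike. *)
pose h : P := if S == set0 then 'X_a else hs S.
have hh : h \is 1.-homog by rewrite /h; case: ifP => _; rewrite ?homogXU ?hs_homog.
have uh : h * xs (O :\ a) \is (k - 3).-homog.
  rewrite (_ : (k - 3)%N = (1 + #|O :\ a|)%N); last by rewrite -Oc (cardsD1 a) aO.
  by apply: dhomogM => //; apply: xs_homog.
pose y := h * xs (O :\ a) * 'X_a ^+ 2.
have idc p : subst (LL T None) p = subst (ell T c) p.
  by rewrite subst_LL subst_id.
have cS : c \notin S by rewrite !inE eqxx.
have ellx j : j != c -> ell T c j = 'X_j by rewrite /ell => /negPf->.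
apply: (@cKD_lt_dimQP d (fun p => (subst (LL T None) p)@_(iter d (mlift c) (msq O U_(a))))
   (W (enum S) y)).
- rewrite -(addn1 d); apply: (KK_LL_spike r2).
  + by rewrite msqE (negPf cO) mnm1E (negPf ac).
  + exact: spike_sq1.
  + by rewrite mdeg_msq Oc mdeg1; move: r3; clear; lia.
- rewrite mcoeff_LL_W -?cardE // all_enum_sub subD1set mul1r idc /y substM substXn substXU ellx //.
  have -> : subst (ell T c) (h * xs (O :\ a)) = h * xs (O :\ a).
    rewrite substM subst_xs_id => [|j]; last first.
      rewrite !inE => /andP[_ jO]; apply: ellx; apply: contraNneq jO => ->.
      by rewrite eqxx.
    congr (_ * _); rewrite /h; case: ifP => _; first by rewrite substXU ellx.
    rewrite subst_hs; apply: eq_bigr => j jS; apply: ellx.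
    by apply: contraTneq jS => ->.
  rewrite (mcoeff_mul_sqr _ _ uh) ?Oc // mcoeffXU eqxx mulr1 /h.
  have ia : ('X_a * xs (O :\ a))@_(ind O) = 1 by rewrite -xsD1 // xsE mcoeffX eqxx.
  case: (eqVneq S set0) => [//|S0]; rewrite (hsD1 (aS S0)) mulrDl mcoeffD ia.
  rewrite /hs mulr_suml linear_sum /= big1 ?addr0 // => j; rewrite !inE => /andP[ja _].
  have [jO|jO] := boolP (j \in O :\ a); last first.
    rewrite xsU1 // xsE mcoeffX; case: eqP => // /ind_inj/setP/(_ a).
    by rewrite aO !inE eqxx eq_sym (negPf ja).
  rewrite -[X in X@__]subst_id; apply: mcoeff_subst_dup => //.
    by move=> ?; apply: homogXU.
  by rewrite subset_leq_card // subD1set.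
- case=> T' [t|] /and3P[T'0 vt /= hT'].
    rewrite andbF orbF in hT'; rewrite phi_W // -?cardE // all_enum_sub.
    have [ST|] := boolP (S \subset T'); last by rewrite mul0r.
    have SeT : S = T' by apply/eqP; rewrite eqEcard ST Sd.
    rewrite -SeT in T'0 *; rewrite /y /h (negPf T'0) !substM LL_hs // !mul0r.
    by rewrite mcoeff0 mulr0.
  rewrite phi_W // -?cardE // /y /= -msq0 (@mcoeff_subst_sqr0 _ _ _ _ (k - 3)) ?mulr0 //.
    exact: lin_LL.
  by rewrite cardsC1 card_ord /=; move: r3; clear; lia.
Qed.

(** The extra spike has only k - 5 odd exponents after the first letters are removed, whereas every
    [phi] requires r of them at that place, so the whole family vanishes on the test. *)
Lemma cKD_lt_big d : (5 <= r)%N -> (1 <= d)%N ->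
  (cKD k d.+1 < dimQP k (r * (2 ^ d.+1 - 1)))%N.
Proof.
move=> r5; case: d => // d _; set c := pv [set (ord0 : 'I_k)].
have c0 : c = ord0.
  by apply/set1P/pvP; apply/set0Pn; exists ord0; rewrite set11.
have [|A Ac Ad] := @exists_subset_card _ [set~ c] (k - 5).
  by rewrite cardsC1 card_ord /=; move: r5; clear; lia.
have [a aA] : exists a, a \in A by apply/set0Pn; rewrite -card_gt0 Ad; move: r5; clear; lia.
have cA : c \notin A by apply/negP => /(subsetP Ac); rewrite !inE eqxx.
have ac : a != c by apply: contraNneq cA => <-.
(* The exponent is 15 at [a], 3 on the rest of [A] and 0 elsewhere, of total degree 15 + 3(k - 6) =
   3r; k >= 6 makes [A] nonempty. *)
pose m := msq A (msq A (msq [set a] U_(a))).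
have T0 : [set (ord0 : 'I_k)] != set0 by apply/set0Pn; exists ord0; rewrite set11.
apply: (@cKD_lt_dimQP d.+1 (fun p => (subst (LL [set ord0] None) p)@_(iter d (mlift c) m))
   (W (nseq d c) 'X_[m])).
- rewrite -(addn2 d); apply: (KK_LL_spike r2); rewrite -/c.
  + by rewrite !msqE !inE (negPf cA) [c == a]eq_sym (negPf ac) mnm1E (negPf ac).
  + move=> i; rewrite !msqE !inE mnm1E [i == a]eq_sym.
    have [<-|_] := eqVneq a i; first by exists 4; rewrite aA.
    by case: (i \in A); [exists 2 | exists 0].
  + by rewrite !mdeg_msq Ad cards1 mdeg1; move: r5; clear; lia.
- rewrite mcoeff_LL_W ?size_nseq // all_nseq [mem _ _](_ : _ = true) ?orbT ?mul1r.
    rewrite subst_LL subst_id substX -/c (_ : \prod_i _ = 'X_[m]).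
      by rewrite mcoeffX eqxx.
    rewrite mpolyXE_id; apply: eq_bigr => i _; rewrite /ell; case: eqP => // ->.
    by rewrite !msqE !inE (negPf cA) [c == a]eq_sym (negPf ac) mnm1E (negPf ac) !expr0.
  by rewrite c0 /= inE.
- case=> T t /and3P[T'0 vt _]; rewrite /phi /= -iterS iterSr.
  rewrite mcoeff_LL_W ?size_nseq // mpolyX_msq (@mcoeff_subst_sqr0 _ _ _ _ (k - 5)) ?mulr0 //.
  + exact: lin_LL.
  + by rewrite -Ad xs_homog.
  + by rewrite cardsC1 card_ord /=; move: r5; clear; lia.
Qed.

End LowerBound.

(** * Degree supports and the chi-trick *)

Section Support.
Variable k : nat.
Local Notation P := {mpoly 'F_2[k]}.
Implicit Types (p q u z y : P) (m : 'X_{1..k}) (i : 'I_k) (B C J : {set 'I_k}).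
Implicit Types (D : 'X_{1..k} -> Prop).

Definition supported D p := forall m, m \in msupp p -> D m.

Lemma supportedX D m : D m -> supported D 'X_[m].
Proof. by move=> Dm m'; rewrite msuppX inE => /eqP ->. Qed.

Lemma supported0 D : supported D 0.
Proof. by move=> m; rewrite msupp0. Qed.

Lemma supportedD D p q : supported D p -> supported D q -> supported D (p + q).
Proof.
move=> hp hq m /msuppD_le; rewrite mem_cat => /orP[]; [exact: hp | exact: hq].
Qed.

Lemma supportedM D1 D2 D p q : (forall a b, D1 a -> D2 b -> D (a + b)%MM) ->
  supported D1 p -> supported D2 q -> supported D (p * q).
Proof.
move=> h hp hq m /msuppM_le /allpairsP[[a b] /= [ap bq ->]].
by apply: h; [apply: hp | apply: hq].
Qed.

Lemma KK_supported n f p : KK n f -> supported (fun m => mdeg m != n) p -> f p = 0.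
Proof.
move=> Kf hp; rewrite [p]mpolyE (KK_sum _ _ _ Kf) big_seq big1 // => m pm.
have := pm; rewrite mcoeff_msupp => /F2_neq0 ->; rewrite scale1r (KKdeg Kf) //.
exact: hp.
Qed.

Lemma Sq_high m : supported (fun a => (mdeg m < mdeg a)%N) (Sq 'X_[m] + 'X_[m]).
Proof.
move=> a; rewrite mcoeff_msupp; apply: contraNT; rewrite -leqNgt => am.
by rewrite mcoeffD mcoeff_Sq_ge // mcoeffX F2_addxx.
Qed.

(** The binomials vanish as soon as some a_i > 2 m_i, so in degree at least 2 deg m only the square
    of x^m remains. *)
Lemma Sq_low m : supported (fun a => (mdeg a < 2 * mdeg m)%N) (Sq 'X_[m] + 'X_[m] ^+ 2).
Proof.
move=> a; rewrite mcoeff_msupp; apply: contraNT; rewrite -leqNgt => ma.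
rewrite mcoeffD mcoeffXn mcoeff_SqX.
have [/forallP le_am|] := boolP [forall i, a i <= 2 * m i]%N; last first.
  rewrite negb_forall => /existsP[i]; rewrite -ltnNge => lt_a.
  rewrite (bigD1 i) //= bin_small ?muln0 ?mul0r ?add0r; last by lia.
  by case: (_ =P a) => // e; move: lt_a; rewrite -e mulmnE; lia.
have e : (m *+ 2)%MM = a.
  apply/mnmP => i; rewrite mulmnE.
  have : (\sum_i (2 * m i - a i) = 0)%N.
    by rewrite sumnB // -big_distrr -!mdegE; apply/eqP; rewrite subn_eq0.
  by move/eqP; rewrite sum_nat_eq0 => /forallP /(_ i) /= /eqP; have := le_am i; lia.
rewrite e eqxx big1 ?F2_addxx // => i _.
by rewrite -e mulmnE (_ : (m i * 2 - m i = m i)%N) ?binn ?leq_pmulr //; lia.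
Qed.

Definition sumpow c (n : nat) := exists2 s : seq nat, size s = c & n = (\sum_(j <- s) 2 ^ j)%N.

Lemma sumpow_prod N B :
  supported (fun m => sumpow #|B| (mdeg m)) (\prod_(i in B) \sum_(j < N) ('X_i : P) ^+ (2 ^ j)).
Proof.
rewrite -sum1_card.
apply: (big_rec2 (fun (c : nat) p => supported (fun m => sumpow c (mdeg m)) p)).
  rewrite -mpolyX0; apply: supportedX; exists [::]; rewrite ?big_nil //.
  exact: mdeg0.
move=> i c p _ hp; apply: (supportedM (D1 := fun m => sumpow 1 (mdeg m))) hp.
  move=> a b [s1 z1 e1] [s2 z2 e2]; exists (s1 ++ s2); first by rewrite size_cat z1 z2.
  by rewrite mdegD e1 e2 big_cat.
elim/big_ind: _ => [||j _]; [exact: supported0 | exact: supportedD | ].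
rewrite mpolyXn; apply: supportedX; exists [:: j : nat] => //.
by rewrite mdegMn mdeg1 mul1n big_seq1.
Qed.

Lemma high_prod n N B : (n < 2 ^ N)%N ->
  supported (fun m => (n < mdeg m)%N) (\prod_(i in B) ('X_i + 'X_i ^+ (2 ^ N) : P) + xs B).
Proof.
move=> nN; rewrite /xs.
apply: (big_rec2 (fun p q => supported (fun m => (n < mdeg m)%N) (p + q))).
  by rewrite addpp; apply: supported0.
have high p q : supported (fun m => (n < mdeg m)%N) q ->
    supported (fun m => (n < mdeg m)%N) (p * q).
  apply: (supportedM (D1 := fun=> True)) => // a b _ nb.
  by rewrite mdegD (leq_trans nb) ?leq_addl.
move=> i p q _ hpq.
rewrite (_ : _ + _ = 'X_i * (p + q) + p * 'X_i ^+ (2 ^ N)); last by ring.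
apply: supportedD; first exact: high.
apply: high; rewrite mpolyXn; apply: supportedX.
by rewrite mdegMn mdeg1 mul1n.
Qed.

(** The sum telescopes because squaring is additive; up to the high term x^(2^N), it is a preimage
    of x under Sq. *)
Lemma Sq_pow2sum N i : Sq (\sum_(j < N) 'X_i ^+ (2 ^ j)) = 'X_i + 'X_i ^+ (2 ^ N).
Proof.
elim: N => [|N IH]; first by rewrite big_ord0 Sq0 expr1 addpp.
rewrite big_ord_recr /= SqD IH SqXn SqXU.
have -> : ('X_i + 'X_i ^+ 2 : P) ^+ (2 ^ N) = 'X_i ^+ (2 ^ N) + 'X_i ^+ (2 ^ N.+1).
  elim: N {IH} => [|N IH]; first by rewrite !expr1.
  by rewrite expnSr exprM IH sqrpD -!exprM -!expnSr.
by rewrite addrA -(addrA 'X_i) addpp addr0.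
Qed.

(* The chi-trick: [u * Sq v] and [chi(Sq) u * v] agree modulo hit elements, and
   [chi(Sq) x = x + x^2 + x^4 + ...]. *)
Lemma KK_star n f B p : KK n f ->
  (forall s : seq nat, size s = #|B| -> (2 * \sum_(j <- s) 2 ^ j != n + #|B|)%N) ->
  f (xs B * p ^+ 2) = 0.
Proof.
move=> Kf hs; elim/mpoly_add_ind: p => [|m|p q hp hq]; last first.
- by rewrite sqrpD mulrDr (KKD Kf) hp hq addr0.
- have [nB|nB] := eqVneq (#|B| + 2 * mdeg m)%N n; last first.
    by rewrite -mpolyX_msq (KKdeg Kf) ?mdeg_msq.
  pose N := n.
  have nN : (n < 2 ^ N)%N by apply: ltn_expl.
  pose v := \prod_(i in B) \sum_(j < N) ('X_i : P) ^+ (2 ^ j).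
  (* A term of degree n would have 2^(j_1) + ... + deg m = n = #|B| + 2 deg m, which is the equality
     excluded by [hs] after doubling. *)
  have fv : f (v * 'X_[m]) = 0.
    apply: (KK_supported Kf).
    apply: (supportedM (D1 := fun m => sumpow #|B| (mdeg m)) (D2 := eq m)).
    + move=> a b [s zs ea] <-; rewrite mdegD ea; apply: contraNneq (hs s zs) => e.
      by apply/eqP; lia.
    + exact: sumpow_prod.
    + exact: supportedX.
  have := KKS Kf (v * 'X_[m]); rewrite fv SqM Sq_prod.
  under eq_bigr => i _ do rewrite Sq_pow2sum.
  set A := \prod_(i in B) _; set Z := Sq 'X_[m].
  (* The two error terms live in degrees below [n] and above [n] respectively, so [f] only sees the
     main term. *)
  have -> : A * Z = xs B * 'X_[m] ^+ 2 + (xs B * (Z + 'X_[m] ^+ 2) + Z * (A + xs B)).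
    move: (xs B) ('X_[m] ^+ 2) => b x.
    have -> : b * x + (b * (Z + x) + Z * (A + b)) =
       A * Z + (b * x + b * x) + (b * Z + b * Z) by ring.
    by rewrite !addpp !addr0.
  rewrite (KKD Kf) => <-; rewrite [X in _ + X](KK_supported Kf) ?addr0 //.
  apply: supportedD.
    apply: (supportedM (D1 := fun a => mdeg a = #|B|)
       (D2 := fun a => (mdeg a < 2 * mdeg m)%N)).
    + by move=> a b ea lb; rewrite mdegD ea neq_ltn -nB ltn_add2l lb.
    + by rewrite xsE; apply: supportedX; rewrite mdeg_ind.
    + exact: Sq_low.
  apply: (supportedM (D1 := fun=> True) (D2 := fun a => (n < mdeg a)%N)) => //.
  + by move=> a b _ lb; rewrite mdegD neq_ltn (leq_trans lb) ?leq_addl ?orbT.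
  + exact: high_prod.
- by rewrite expr0n mulr0 (KK0 Kf).
Qed.

Lemma KK_sqr0 n f p : KK n f -> (0 < n)%N -> f (p ^+ 2) = 0.
Proof.
move=> Kf n0; have := @KK_star n f set0 p Kf; rewrite /xs big_set0 mul1r; apply.
by rewrite cards0 => s /size0nil ->; rewrite big_nil; lia.
Qed.

Lemma Sq_xs C : Sq (xs C) = \sum_(J : {set 'I_k} | J \subset C) xs (C :\: J) * xs J ^+ 2.
Proof.
rewrite /xs Sq_prod big_mkcond /=.
under eq_bigr => i _.
  rewrite SqXU (_ : (if i \in C then _ else _) =
    (if i \in C then 'X_i ^+ 2 else 0) + (if i \in C then 'X_i else 1)); last first.
    by case: ifP => _; rewrite ?add0r // addrC.
  over.
rewrite bigA_distr [RHS]big_mkcond /=; apply: eq_bigr => J _.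
case: ifPn => [JC|/subsetPn[i iJ iC]]; last by rewrite (bigD1 i) //= iJ (negPf iC) mul0r.
rewrite -prodrXl [in RHS]big_mkcond [X in _ * X]big_mkcond -big_split /=.
apply: eq_bigr => i _; rewrite inE; case: ifPn => iJ.
  by rewrite (subsetP JC _ iJ) mul1r.
by rewrite mulr1.
Qed.

End Support.

(** * Functionals indexed by words, and their dependence on the support *)

Section Words.
Variable r : nat.
Local Notation k := r.+1.
Local Notation P := {mpoly 'F_2[k]}.
Implicit Types (p q u z y g : P) (m : 'X_{1..k}) (i a b c : 'I_k) (B C J S T : {set 'I_k}).
Implicit Types (f : P -> 'F_2) (w : seq 'I_k).

Local Notation deg e := (r * (2 ^ e - 1))%N.

Definition star e := forall f B p, KK (deg e) f -> #|B| != r -> f (xs B * p ^+ 2) = 0.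

Lemma card_setC1 i : #|[set~ i]| = r.
Proof. by rewrite cardsC1 card_ord. Qed.

Lemma degS e : deg e.+1 = (r + 2 * deg e)%N.
Proof.
rewrite expnS; have := expn_gt0 2 e; case: (2 ^ e)%N => // t _.
by rewrite !subn1 /=; lia.
Qed.

Lemma pv1 i : pv [set i] = i.
Proof. by apply/set1P/pvP/set0Pn; exists i; rewrite set11. Qed.

Definition fI f i p := f (xs [set~ i] * p ^+ 2).

(** In Sq(X_i p^2) every term with a nonempty set J of squared variables has fewer than r odd
    variables up to a square, and [star] kills it. *)
Lemma KK_fI e f i : star e.+1 -> KK (deg e.+1) f -> KK (deg e) (fI f i).
Proof.
move=> st Kf; split=> [p q|p|m mn]; rewrite /fI.
- by rewrite sqrpD mulrDr (KKD Kf).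
- rewrite -[RHS](KKS Kf) SqM SqXn Sq_xs mulr_suml (KK_sum _ _ _ Kf).
  rewrite (bigD1 set0) ?sub0set //= setD0 /xs big_set0 expr1n mulr1 -/(xs _).
  rewrite [X in _ = _ + X]big1 ?addr0 // => J /andP[JC J0].
  have Jr : (#|J| <= r)%N by rewrite (leq_trans (subset_leq_card JC)) ?card_setC1.
  rewrite -mulrA -exprMn st // cardsD (setIidPr JC) card_setC1.
  by move: Jr J0; rewrite -card_gt0; clear; lia.
- rewrite -mpolyX_msq (KKdeg Kf) // mdeg_msq card_setC1 degS.
  by rewrite eqn_add2l eqn_pmul2l.
Qed.

(** Invariance is applied to x_1...x_k g^2, on which [f] vanishes by [star]. In its total square
    only the terms squaring a single x_i survive, which gives the relation with Sq g in place of g;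
    the higher part of Sq g then drops out by degree. *)
Lemma KK_rel e f g : star e -> KK (deg e) f -> \sum_i fI f i ('X_i * g) = 0.
Proof.
move=> st Kf; elim/mpoly_add_ind: g => [|m|p q hp hq]; last first.
- under eq_bigr => i _ do rewrite /fI mulrDr sqrpD mulrDr (KKD Kf).
  by rewrite big_split -!/(fI _ _ _) /= hp hq addr0.
- have h : \sum_i fI f i ('X_i * Sq 'X_[m]) = 0.
    have := KKS Kf (xs setT * 'X_[m] ^+ 2); rewrite [RHS]st //; last first.
      by rewrite cardsT card_ord neq_ltn ltnSn orbT.
    rewrite SqM SqXn Sq_xs mulr_suml (KK_sum _ _ _ Kf) => h0; rewrite -[RHS]h0 {h0}.
    under [RHS]eq_bigr => J _ do rewrite -mulrA -exprMn setTD.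
    rewrite [RHS](bigID (fun J : {set 'I_k} => #|J| == 1%N)) /= [X in _ = _ + X]big1 ?addr0.
      rewrite [RHS](reindex_onto (fun i : 'I_k => [set i]) (@pv r)) /=.
        apply: eq_big => i; last by rewrite /xs big_set1.
        by rewrite subsetT cards1 pv1 !eqxx.
      by move=> J /andP[_ /cards1P[j ->]]; rewrite pv1.
    move=> J /andP[_ J1]; apply: st => //; apply: contraNneq J1 => e1.
    have := cardsC J; rewrite e1 card_ord addnC => /eqP.
    by rewrite -[X in _ == X]addn1 eqn_add2l.
  have [n0|n0] := eqVneq (r + 2 * (mdeg m).+1)%N (deg e); last first.
    rewrite big1 // => i _; rewrite /fI -mpolyXD -mpolyX_msq (KKdeg Kf) //.
    by rewrite mdeg_msq card_setC1 mdegD mdeg1 add1n.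
  rewrite -[RHS]h; apply: eq_bigr => i _; rewrite /fI.
  apply/esym/F2_add_eq0; rewrite -(KKD Kf) -mulrDr -sqrpD -mulrDr.
  set R := Sq _ + _; apply: (KK_supported Kf).
  have sR : supported (fun a : 'X_{1..k} => mdeg m < mdeg a)%N R := @Sq_high _ m.
  apply: (supportedM (D1 := fun a : 'X_{1..k} => mdeg a = r) (D2 := fun a : 'X_{1..k} => 2 * (mdeg m).+1 < mdeg a)%N).
  + by move=> a b ea lb; rewrite mdegD ea neq_ltn -n0 !ltn_add2l lb orbT.
  + by rewrite xsE; apply: supportedX; rewrite mdeg_ind card_setC1.
  + have h1 : supported (fun a : 'X_{1..k} => (mdeg m).+1 < mdeg a)%N ('X_i * R).
      apply: (supportedM (D1 := fun a : 'X_{1..k} => mdeg a = 1%N)) sR.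
        by move=> a b ea lb; rewrite mdegD ea add1n ltnS.
      by apply: supportedX; rewrite mdeg1.
    rewrite expr2; apply: (supportedM _ h1 h1) => a b la lb.
    by rewrite mdegD mul2n -addnn -addnS leq_add // ltnW.
- by rewrite big1 // => i _; rewrite /fI mulr0 expr0n mulr0 (KK0 Kf).
Qed.

(** Take g to be z^2 times all variables except x_a and x_b. For any other i the product x_i g
    contains x_i^2, hence only r - 2 odd variables; two terms remain. *)
Lemma fam_swap (F : 'I_k -> P -> 'F_2) a b z :
  (forall i B p, #|B| != r -> F i (xs B * p ^+ 2) = 0) ->
  (forall g, \sum_i F i ('X_i * g) = 0) ->
  F a (xs [set~ b] * z ^+ 2) = F b (xs [set~ a] * z ^+ 2).
Proof.
move=> st rel; have [->//|ab] := eqVneq a b.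
have := rel (xs (~: [set a; b]) * z ^+ 2).
rewrite (bigD1 a) //= (bigD1 b) 1?eq_sym //= big1 ?addr0 => [h|i /andP[ia ib]]; last first.
  rewrite (@xsD1 _ _ i) ?inE ?negb_or ?ia ?ib // 2!mulrA -expr2 [_ ^+ 2 * _]mulrC.
  rewrite -mulrA -exprMn st //; apply/eqP => e.
  have := cardsD1 i (~: [set a; b]); rewrite e !inE negb_or ia ib cardsCs setCK card_ord.
  by rewrite cards2 ab; lia.
apply: F2_add_eq0; rewrite -[RHS]h; congr (F _ _ + F _ _); rewrite mulrA xsU1 ?inE ?eqxx ?orbT //;
  congr (xs _ * _); apply/setP => j; rewrite !inE negb_or.
  by have [->|] := eqVneq j a.
by have [->|] := eqVneq j b; rewrite ?andbT // eq_sym.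
Qed.

(** With g = x_1...x_k z^2 one has x_i g = X_i (x_i z)^2, so the relation passes to words longer by
    one letter. *)
Lemma fam_next (F : 'I_k -> P -> 'F_2) z : (forall g, \sum_i F i ('X_i * g) = 0) ->
  \sum_i F i (xs [set~ i] * ('X_i * z) ^+ 2) = 0.
Proof.
move=> rel; rewrite -[RHS](rel (xs setT * z ^+ 2)); apply: eq_bigr => i _.
by rewrite (@xsD1 _ setT i) ?inE // setTD exprMn mulrCA expr2 -!mulrA.
Qed.

Lemma KK_pow_rel e j f z : star e -> KK (deg e) f ->
  \sum_i f (W (nseq j.+1 i) ('X_i * z)) = 0.
Proof.
move=> st Kf; elim: j z => [|j IH] z; first exact: (KK_rel _ st Kf).
have := fam_next (F := fun i p => f (W (nseq j.+1 i) p)) z IH.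
by under eq_bigr => i _ do rewrite -[xs _ * _]/(W [:: i] ('X_i * z)) -W_cat
  -[[:: i]]/(nseq 1 i) -nseqD addn1.
Qed.

Variable e0 : nat.
Hypothesis Hstar : forall e, (e0 <= e)%N -> star e.

(** Going down from e + 1 to e uses [star] at e + 1 only, hence the bound [e0 <= e.+1]. *)
Lemma KK_W e f w : (e0 <= e.+1)%N -> KK (deg (e + size w)) f ->
  KK (deg e) (fun y => f (W w y)).
Proof.
move=> e0e; elim: w f => [|i w IH] f Kf; first by rewrite addn0 in Kf.
apply: (IH (fI f i)); apply: KK_fI; last by rewrite -addnS.
by apply: Hstar; lia.
Qed.

Lemma W_swap e f a b w y : (e0 <= e.+1)%N -> KK (deg (e + (size w).+2)) f ->
  f (W (a :: b :: w) y) = f (W (b :: a :: w) y).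
Proof.
move=> e0e Kf; rewrite /=.
apply: (fam_swap (F := fI f)) => [i B p Br|g].
  apply: (Hstar (e := e + (size w).+1)); [lia | | by []].
  by apply: KK_fI; [apply: Hstar; lia | rewrite -addnS].
by apply: (KK_rel (e := e + (size w).+2)) => //; apply: Hstar; lia.
Qed.

Lemma W_move e f a w1 w2 y : (e0 <= e.+1)%N -> KK (deg (e + size (a :: w1 ++ w2))) f ->
  f (W (a :: w1 ++ w2) y) = f (W (w1 ++ a :: w2) y).
Proof.
move=> e0e; elim: w1 f => // b w1 IH f Kf.
rewrite !cat_cons (W_swap (e := e)) //=.
apply: (IH (fI f b)); apply: KK_fI; last by rewrite -addnS.
by apply: Hstar; lia.
Qed.

Lemma W_perm e f w w' y : (e0 <= e.+1)%N -> KK (deg (e + size w)) f ->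
  perm_eq w w' -> f (W w y) = f (W w' y).
Proof.
move=> e0e; elim: w w' f => [|a w IH] w' f Kf pw.
  by move: pw; rewrite perm_sym => /perm_nilP ->.
have aw : a \in w' by rewrite -(perm_mem pw) mem_head.
case/splitPr: aw pw Kf => w1 w2 pw Kf.
have pw' : perm_eq w (w1 ++ w2).
  by rewrite -(perm_cons a) (permPl pw) -cat1s perm_catCA.
rewrite -(W_move (e := e)) //; last first.
  by rewrite /= -(perm_size pw').
apply: (IH _ (fI f a)) => //; apply: KK_fI; last by rewrite -addnS.
by apply: Hstar; lia.
Qed.

(** The family i -> f_(ii) satisfies the relation of [KK_pow_rel], so [fam_swap] exchanges aab and
    bba; permuting letters gives abb. *)
Lemma W_double e f a b w y : (e0 <= e.+1)%N -> KK (deg (e + (size w).+3)) f ->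
  f (W (a :: a :: b :: w) y) = f (W (a :: b :: b :: w) y).
Proof.
move=> e0e Kf; transitivity (f (W [:: b, b, a & w] y)); last first.
  apply: (@W_perm e f _ _ y e0e); first exact: Kf.
  by rewrite -[X in perm_eq X]/([:: b; b] ++ [:: a] ++ w) perm_catCA.
have st3 : star (e + (size w).+3) by apply: Hstar; lia.
apply: (fam_swap (F := fun i p => f (W [:: i; i] p))) => [i B p Br|g].
  have K2 : KK (deg (e + (size w).+1)) (fun y => f (W [:: i; i] y)).
    by apply: KK_W; [lia | rewrite addn2 -!addnS].
  have st1 : star (e + (size w).+1) by apply: Hstar; lia.
  exact: (st1 _ _ _ K2 Br).
exact: (@KK_pow_rel _ 1 _ _ st3 Kf).
Qed.

Lemma W_replace e f w a b v y : (e0 <= e.+1)%N -> a \in w -> b \in w ->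
  KK (deg (e + size (w ++ a :: v))) f -> f (W (w ++ a :: v) y) = f (W (w ++ b :: v) y).
Proof.
move=> e0e aw bw Kf; have [->//|ab] := eqVneq a b.
have pw : perm_eq w [:: a, b & rem b (rem a w)].
  rewrite (permPl (perm_to_rem aw)) perm_cons perm_to_rem //.
  by move: bw; rewrite (perm_mem (perm_to_rem aw)) inE eq_sym (negPf ab).
set u := rem b (rem a w) in pw.
have pc c : perm_eq (w ++ c :: v) [:: a, c, b & u ++ v].
  rewrite -cat1s perm_catCA /= perm_sym.
  rewrite -[[:: a, c, b & u ++ v]]/([:: a] ++ [:: c] ++ b :: u ++ v) perm_catCA /= perm_cons.
  by rewrite perm_sym -[[:: a, b & u ++ v]]/([:: a, b & u] ++ v) perm_cat2r.
have sz : size (w ++ a :: v) = (size (u ++ v)).+3 by rewrite (perm_size (pc a)).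
rewrite (W_perm (e := e) y e0e Kf (pc a)).
rewrite [RHS](W_perm (e := e) y e0e _ (pc b)); last first.
  by move: Kf; rewrite !size_cat.
rewrite sz in Kf; rewrite (W_double (e := e)) //.
Qed.

Lemma W_fill e f w v a y : (e0 <= e.+1)%N -> a \in w -> {subset v <= w} ->
  KK (deg (e + size (w ++ v))) f -> f (W (w ++ v) y) = f (W (w ++ nseq (size v) a) y).
Proof.
move=> e0e; elim: v w => [|b v IH] w aw vw Kf //.
rewrite (W_replace (b := a) (e := e)) //; last by apply: vw; rewrite mem_head.
rewrite -[a :: v]cat1s -[nseq _ _]/([:: a] ++ nseq (size v) a) !catA IH //.
- by rewrite mem_cat aw.
- by move=> c cv; rewrite mem_cat vw // inE cv orbT.
- by move: Kf; rewrite !size_cat /= -addnA.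
Qed.

Lemma perm_undup_cat (X : eqType) (w : seq X) :
  exists2 v, perm_eq w (undup w ++ v) & {subset v <= w}.
Proof.
elim: w => [|a w [v pv vw]]; first by exists [::].
rewrite /=; case: ifP => aw; last first.
  exists v; first by rewrite /= perm_cons.
  by move=> b /vw bw; rewrite inE bw orbT.
exists (a :: v); first by rewrite perm_sym -[a :: v]cat1s perm_catCA /= perm_cons perm_sym.
move=> b; rewrite !inE => /orP[->//|/vw ->]; exact: orbT.
Qed.

(** Both words reduce to the same normal form: the distinct letters once each, followed by copies of
    one fixed letter. *)
Lemma W_support e f w w' y : (e0 <= e.+1)%N -> size w = size w' -> w =i w' ->
  KK (deg (e + size w)) f -> f (W w y) = f (W w' y).
Proof.
move=> e0e sz ww Kf; have Kf' := Kf; rewrite sz in Kf'.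
case: (w =P [::]) => [w0|/eqP w0].
  by move: sz; rewrite w0 /= => /esym/size0nil ->.
have [a aw] : exists a, a \in w by case: (w) w0 => // a u _; exists a; rewrite mem_head.
have [v pv vw] := perm_undup_cat w; have [v' pv' vw'] := perm_undup_cat w'.
rewrite (W_perm y e0e Kf pv) (W_perm y e0e Kf' pv').
have pu : perm_eq (undup w) (undup w').
  by apply: uniq_perm; rewrite ?undup_uniq // => b; rewrite !mem_undup.
rewrite (W_fill (e := e) (a := a)) ?mem_undup //; first last.
- by rewrite -(perm_size pv).
- by move=> b /vw; rewrite mem_undup.
rewrite [RHS](W_fill (e := e) (a := a)) ?mem_undup -?ww //; first last.
- by rewrite -(perm_size pv').
- by move=> b /vw'; rewrite mem_undup.
have svv : size v = size v'.
  have := perm_size pv; have := perm_size pv'; rewrite !size_cat (perm_size pu) sz.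
  by move=> -> /addnI.
apply: (W_perm (e := e)) => //; first by rewrite size_cat size_nseq -size_cat -(perm_size pv).
by rewrite svv perm_cat2r.
Qed.

(** A monomial is x_B times a square. [star] disposes of it unless [B] omits exactly one index,
    which becomes the next letter. *)
Lemma KK_descend e l f : (e0 <= e.+1)%N -> KK (deg (e + l)) f ->
  (forall w y, size w = l -> f (W w y) = 0) -> forall p, f p = 0.
Proof.
move=> e0e; elim: l f => [|l IH] f Kf h p; first exact: (h [::]).
elim/mpoly_add_ind: p => [|m|p q hp hq]; last first.
- by rewrite (KKD Kf) hp hq addr0.
- have [B [m' ->]] := msq_surj m; rewrite mpolyX_msq.
  have st : star (e + l.+1) by apply: Hstar; lia.
  have [Br|] := eqVneq #|B| r; last by move=> Br; apply: st Br.
  have /eqP/cards1P[i Bi] : #|~: B| = 1%N by rewrite cardsCs setCK card_ord Br subSnn.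
  have -> : B = [set~ i] by rewrite -Bi setCK.
  apply: (IH (fI f i)); first by apply: KK_fI; rewrite -addnS.
  by move=> w y wl; apply: (h (i :: w)); rewrite /= wl.
- exact: KK0 Kf.
Qed.

End Words.

(** * The chi-trick for k = 3, 4, 5, and the upper bound for k = 3 *)

Lemma pow2_cases j : (2 ^ j = 1 \/ exists t, 2 ^ j = 2 * t)%N.
Proof. by case: j => [|j]; [left | right; exists (2 ^ j)%N; rewrite expnS]. Qed.

Lemma starP r e :
  (forall s : seq nat, size s <> r -> (size s <= r.+1)%N ->
     (2 * \sum_(j <- s) 2 ^ j <> r * (2 ^ e - 1) + size s)%N) ->
  star r e.
Proof.
move=> h f B p Kf /eqP Br; apply: (KK_star _ Kf) => s sB; apply/eqP.
rewrite -sB; apply: h; rewrite sB //.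
by rewrite -[X in (_ <= X)%N](card_ord r.+1) max_card.
Qed.

Lemma star2 e : (1 <= e)%N -> star 2 e.
Proof.
case: e => // e _; apply: starP => s s2 s3; rewrite expnS.
have := expn_gt0 2 e; move: (2 ^ e)%N => t /= t0.
case: s s2 s3 => [|a s] s2 s3; first by rewrite big_nil /=; lia.
move: (\sum_(_ <- _) _)%N => u; case: s s2 s3 => [|b [|c [|x s]]] //= s2 s3; lia.
Qed.

(** Parity leaves only size 1, that is 2^j = 3 2^(e-1) - 1, which is odd and greater than 1 for e >=
    2. *)
Lemma star3 e : (2 <= e)%N -> star 3 e.
Proof.
case: e => [|[|e]] // _; apply: starP => s s2 s3; rewrite 2!expnS.
have := expn_gt0 2 e; move: (2 ^ e)%N => t /= t0.
case: s s2 s3 => [|a [|b s]] s2 s3; first by rewrite big_nil /=; lia.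
  by rewrite big_seq1 /=; have [->|[u ->]] := pow2_cases a; lia.
move: (\sum_(_ <- _) _)%N => u; case: s s2 s3 => [|c [|x [|x' s]]] //= s2 s3; lia.
Qed.

(** Parity and positivity leave only size 2, that is 2^a + 2^b = 2^(e+1) - 1. One power is then 1
    and the other 2^(e+1) - 2, which is no power of two for e >= 2. *)
Lemma star4 e : (2 <= e)%N -> star 4 e.
Proof.
case: e => [|[|e]] // _; apply: starP => s s2 s3; rewrite 2!expnS.
have := expn_gt0 2 e; move: (2 ^ e)%N => t /= t0.
have aux j : (2 ^ j <> 2 * (2 * (2 * t)) - 2)%N.
  case: j => [|j]; first by lia.
  by rewrite expnS; have [->|[u ->]] := pow2_cases j; lia.
case: s s2 s3 => [|a [|b [|c s]]] s2 s3; first by rewrite big_nil /=; lia.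
- by rewrite big_seq1 /=; lia.
- rewrite big_cons big_seq1 /=; have := aux a; have := aux b.
  by have [->|[u ->]] := pow2_cases a; have [->|[v ->]] := pow2_cases b; lia.
move: (\sum_(_ <- _) _)%N => u; case: s s2 s3 => [|x [|x' [|x'' s]]] //= s2 s3; lia.
Qed.

Lemma mem_wd r d (T : {set 'I_r.+1}) : T != set0 -> wd d T =i T.
Proof.
move=> T0 i; rewrite mem_cat mem_enum; case iT: (i \in T) => //=.
apply/negP => /nseqP[ei _]; by rewrite ei pvP in iT.
Qed.

(** For r = 2 the descent reaches degree 0, where only constants remain, so one test per possible
    support of a word of length [d.+1] suffices; the second sum of [cKD] has factor k - 3 = 0. *)
Lemma dimQP3_le d : (dimQP 3 (2 * (2 ^ d.+1 - 1)) <= cKD 3 d.+1)%N.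
Proof.
have -> : cKD 3 d.+1 = #|idx1 2 d|.
  rewrite card_sig /cKD subnn !mul0n addn0 -card_small_sets.
  by apply: eq_card => T; rewrite !inE.
apply: (@dimQP_le _ _ _ (fun T : idx1 2 d => W (wd d.+1 (val T)) 1)) => f Kf hf.
apply: (@KK_descend 2 1 star2 0 d.+1) => // w y wd'.
have K0 : KK (2 * (2 ^ 0 - 1)) (fun y => f (W w y)).
  by apply: (@KK_W 2 1 star2 0); rewrite // wd'.
move: y; elim/mpoly_add_ind => [|m|p q hp hq]; last first.
- by rewrite (KKD K0) hp hq addr0.
- have [/eqP|m0] := eqVneq (mdeg m) 0%N; last exact: (KKdeg K0).
  rewrite mdeg_eq0 => /eqP ->; rewrite mpolyX0.
  pose T := [set i in w].
  have T0 : T != set0.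
    case: w wd' {K0} @T => // a w _; apply/set0Pn; exists a.
    by rewrite inE mem_head.
  have Td : (#|T| <= d.+1)%N by rewrite -wd' cardsE card_size.
  have TP : (0 < #|T| <= d.+1)%N by rewrite card_gt0 T0.
  rewrite (@W_support 2 1 star2 0 f w (wd d.+1 T)) ?size_wd //.
  + exact: (hf (exist _ T TP)).
  + by move=> i; rewrite mem_wd // inE.
  + by rewrite wd'.
- exact: KK0 K0.
Qed.

(** * Invariant functionals in degree r *)

Section Base.
Variable r : nat.
Hypothesis r2 : (2 <= r)%N.
Local Notation k := r.+1.
Local Notation P := {mpoly 'F_2[k]}.
Implicit Types (p q u z y : P) (m : 'X_{1..k}) (i a b c : 'I_k) (B C J S T E : {set 'I_k}).

Lemma ell_mod S (i0 : 'I_k) p : i0 \in S -> exists z, p = subst (ell S i0) p + hs S * z.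
Proof.
move=> iS; elim/mpoly_ring_ind: p => [||i|p q [z hz] [z' hz']|p q [z hz] [z' hz']].
- by exists 0; rewrite subst0 mulr0 addr0.
- by exists 0; rewrite subst1 mulr0 addr0.
- rewrite substXU /ell; case: eqP => [->|_]; last by exists 0; rewrite mulr0 addr0.
  by exists 1; rewrite mulr1 (hsD1 iS) addrCA addpp addr0.
- exists (z + z'); rewrite substD mulrDr [LHS](congr2 _ hz hz').
  by rewrite addrACA.
- exists (subst (ell S i0) p * z' + z * subst (ell S i0) q + hs S * z * z').
  rewrite substM [LHS](congr2 _ hz hz').
  move: (subst _ p) (subst _ q) (hs S) => P1 P2 h; ring.
Qed.

Lemma ell_free S (i0 : 'I_k) p :
  supported (fun m : 'X_{1..k} => m i0 = 0%N) (subst (ell S i0) p).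
Proof.
elim/mpoly_ring_ind: p => [||i|p q hp hq|p q hp hq].
- by rewrite subst0; apply: supported0.
- by rewrite subst1 -mpolyX0; apply: supportedX; rewrite mnm0E.
- rewrite substXU /ell; case: (i =P i0) => [_|/eqP ii].
    rewrite /hs; elim/big_ind: _ => [||t]; [exact: supported0|exact: supportedD|].
    by rewrite !inE => /andP[/negPf ti _]; apply: supportedX; rewrite mnm1E ti.
  by apply: supportedX; rewrite mnm1E (negPf ii).
- by rewrite substD; apply: supportedD.
- rewrite substM; apply: supportedM hp hq => a b ha hb.
  by rewrite mnmDE ha hb.
Qed.

(** Write the monomial as x_B (x^q)^2 with #|B| + 2 deg q = r <= 4. If deg q = 0 it is X_i0; if deg
    q >= 2 it is a square, killed by [KK_sqr0]. If q is a variable x_a, it is a test with [i0]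
    outside [E] when a is in [B], and one with [i0] in [E] otherwise, except when [a = bb i0 E]. *)
Lemma KK_base_monomial (g : P -> 'F_2) (i0 : 'I_k) m : (r <= 4)%N -> KK r g ->
  (forall t, valid i0 t -> g (ytau i0 t) = 0) -> m i0 = 0%N -> g 'X_[m] = 0.
Proof.
move=> r4 Kg hg; have [B [q ->]] := msq_surj m; rewrite msqE => mi0.
have iB : i0 \notin B by case: (i0 \in B) mi0.
have qi : q i0 = 0%N by move: mi0; lia.
have [dB|] := eqVneq (#|B| + 2 * mdeg q)%N r; last first.
  by move=> dB; rewrite (KKdeg Kg) // mdeg_msq.
have BC : #|~: (i0 |: B)| = (r - #|B|)%N.
  by rewrite cardsCs setCK card_ord cardsU1 iB subSS.
have [q0|q1] := eqVneq (mdeg q) 0%N.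
  have B0 : B = [set~ i0].
    apply/eqP; rewrite eqEcard cardsC1 card_ord; apply/andP; split; last by move: dB; rewrite q0; clear; lia.
    by apply/subsetP => i; rewrite !inE; apply: contraTneq => ->.
  move/eqP: q0; rewrite mdeg_eq0 => /eqP ->; rewrite msq0 -xsE B0.
  exact: (hg None).
have [/eqP/mdeg1P[a /eqP qa]|q2] := eqVneq (mdeg q) 1%N; last first.
  rewrite mpolyX_msq (_ : B = set0) ?/xs ?big_set0 ?mul1r.
    by apply: (KK_sqr0 _ Kg); move: r2; clear; lia.
  apply/eqP; rewrite -cards_eq0; move: dB r4 q1 q2; clear; lia.
have ai : a != i0 by move: qi; rewrite qa mnm1E; case: eqP.
have dB2 : (r - #|B| = 2)%N by move: dB; rewrite qa mdeg1; clear; lia.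
rewrite qa mpolyX_msq; rewrite dB2 in BC.
have [aB|aB] := boolP (a \in B).
  pose E := ~: (i0 |: B); have iE : i0 \in E = false by rewrite !inE eqxx.
  have e : i0 |: E = ~: B.
    by apply/setP => j; rewrite !inE; have [->|] := eqVneq j i0; rewrite ?iB.
  have := hg (Some (E, a)); rewrite /= /bb iE e setCK; apply.
  by rewrite BC eqxx inE negbK.
pose E := i0 |: (~: (i0 |: B) :\ a).
have iE : i0 \in E by rewrite setU11.
have aE : a \notin E by rewrite !inE eqxx (negPf ai).
have E2 : #|E| = 2.
  rewrite cardsU1 !inE eqxx andbF /=.
  by have := cardsD1 a (~: (i0 |: B)); rewrite BC !inE negb_or ai aB add1n => -[<-].
have e : a |: E = ~: B.
  apply/setP => j; rewrite !inE; have [->|ja] := eqVneq j a; first by rewrite aB.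
  by have [->|] := eqVneq j i0; rewrite ?iB.
have yE j : j \notin E -> j != bb i0 E -> g (xs (~: (j |: E)) * 'X_j ^+ 2) = 0.
  move=> jE jb; have := hg (Some (E, j)); rewrite /= iE; apply.
  by rewrite E2 eqxx inE inE negb_or jb.
have [ab|ab] := eqVneq a (bb i0 E); last by rewrite -[B]setCK -e; apply: yE.
(* The excluded monomial comes from Sq^1 x_C, the sum over j in [C] of x_(C - j) x_j^2, all of whose
   other terms vanish under [g] by [yE]. *)
pose C := ~: E; have aC : a \in C by rewrite inE.
have Cr : #|C| = r.-1 by rewrite cardsCs setCK card_ord E2 subn2.
have := KKS Kg (xs C); rewrite [RHS](KK_homog Kg (xs_homog C)); last first.
  by rewrite Cr; move: r2; clear; lia.
have CJ j : C :\: [set j] = ~: (j |: E).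
  by rewrite setDE setIC -setCU.
rewrite Sq_xs (KK_sum _ _ _ Kg) (bigD1 [set a]) ?sub1set //= big1 => [|J /andP[JC Ja]].
  by rewrite addr0 CJ e setCK /xs big_set1.
have [/cards1P[j Jj]|J1] := boolP (#|J| == 1%N).
  rewrite Jj CJ [X in _ * X ^+ 2]/xs big_set1; apply: yE.
    by have := subsetP JC j; rewrite Jj set11 inE; apply.
  by rewrite -ab; apply: contraNneq Ja => <-; rewrite Jj.
have hJ : xs (C :\: J) * xs J ^+ 2 \is (#|C :\: J| + #|J| * 2).-homog.
  by apply: dhomogM; [apply: xs_homog | apply/dhomogMn/xs_homog].
rewrite (KK_homog Kg hJ) // cardsD (setIidPr JC) Cr.
have := subset_leq_card JC; rewrite Cr; move: J1 r2; clear; lia.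
Qed.

(** Since [g] kills the multiples of [hs S], [p] may be replaced by its reduction, which is free of
    the pivot variable. *)
Lemma KK_base (g : P -> 'F_2) S p : (r <= 4)%N -> KK r g -> S != set0 ->
  (forall z, g (hs S * z) = 0) ->
  (forall t, valid (pv S) t -> g (ytau (pv S) t) = 0) -> g p = 0.
Proof.
move=> r4 Kg S0 hz ht; have [z ->] := ell_mod p (pvP S0).
rewrite (KKD Kg) hz addr0; set p' := subst _ _.
have hp' : supported (fun m : 'X_{1..k} => m (pv S) = 0%N) p' := @ell_free _ _ p.
rewrite [p']mpolyE (KK_sum _ _ _ Kg) big_seq big1 // => m pm.
have := pm; rewrite mcoeff_msupp => /F2_neq0 ->; rewrite scale1r.
exact: (KK_base_monomial r4 Kg ht (hp' _ pm)).
Qed.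

End Base.

(** * The upper bound by descending induction on the support *)

Section Upper.
Variable r : nat.
Hypothesis r2 : (2 <= r)%N.
Hypothesis r4 : (r <= 4)%N.
Hypothesis Hstar : forall e, (2 <= e)%N -> star r e.
Local Notation k := r.+1.
Local Notation P := {mpoly 'F_2[k]}.
Implicit Types (p q u z y : P) (m : 'X_{1..k}) (i a b c : 'I_k) (B C J S T E : {set 'I_k}).

Variables (l : nat) (f : P -> 'F_2).
Hypothesis kl : (k <= l)%N.
Hypothesis Kf : KK (r * (2 ^ (1 + l) - 1)) f.

Let fS S y := f (W (wd l S) y).
Let rho S z := \sum_i fS (i |: S) ('X_i * z).

Lemma card_le_l S : (#|S| <= l)%N.
Proof. by rewrite (leq_trans _ kl) // -[X in (_ <= X)%N](card_ord k) max_card. Qed.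

Lemma fS_word S w y : S != set0 -> size w = l -> w =i S -> f (W w y) = fS S y.
Proof.
move=> S0 wl wS; apply: (@W_support r 2 Hstar 1); rewrite ?wl ?size_wd ?card_le_l //.
by move=> i; rewrite wS mem_wd.
Qed.

(** For nonempty [S] this is [KK_rel] for the functional of a word of length [l.-1] with support
    [S], which exists since [S] has fewer than k <= l elements. For empty [S] it is the relation
    between the words i...i. *)
Lemma rho_proper S z : S != setT -> rho S z = 0.
Proof.
move=> ST; have [->|S0] := eqVneq S set0.
  rewrite -[RHS](@KK_pow_rel r (1 + l) l.-1 f z _ Kf); last first.
    by apply: Hstar; move: kl; clear; lia.
  rewrite (prednK (leq_trans (ltn0Sn _) kl)); apply: eq_bigr => i _.
  rewrite setU0; apply/esym/fS_word; rewrite ?size_nseq //.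
    by apply/set0Pn; exists i; rewrite set11.
  by move=> j; rewrite mem_nseq inE (leq_trans (ltn0Sn _) kl).
have Sl : (#|S| <= l.-1)%N.
  have : (#|S| < k)%N by rewrite -[X in (_ < X)%N](card_ord k) -cardsT proper_card // properT.
  by move: kl; clear; lia.
have K2 : KK (r * (2 ^ 2 - 1)) (fun y => f (W (wd l.-1 S) y)).
  apply: (@KK_W r 2 Hstar 2) => //; rewrite size_wd //.
  by rewrite (_ : 2 + l.-1 = 1 + l)%N //; move: kl; clear; lia.
rewrite -[RHS](@KK_rel r 2 _ z (Hstar (leqnn 2)) K2); apply: eq_bigr => i _.
rewrite /fI -[xs _ * _]/(W [:: i] ('X_i * z)) -W_cat; apply/esym/fS_word.
- by apply/set0Pn; exists i; rewrite setU11.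
- by rewrite size_cat size_wd //= addn1 prednK // (leq_trans (ltn0Sn _) kl).
- by move=> j; rewrite mem_cat mem_wd // !inE orbC.
Qed.

(** For i in T the term f_T (x_i z) occurs twice, from S = T and from S = T - i. This yields the
    relation for the full set, which [rho_proper] does not reach. *)
Lemma sum_rho z : \sum_S rho S z = 0.
Proof.
rewrite exchange_big big1 //= => i _.
rewrite (bigID (fun S => i \in S)) /=.
rewrite [X in _ + X](reindex_onto (fun S => S :\ i) (fun S => i |: S)) /=; last first.
  by move=> S iS; rewrite setU1K.
rewrite [X in _ + X](eq_big (fun S => i \in S) (fun S => fS (i |: S) ('X_i * z))).
- exact: F2_addxx.
- move=> S; rewrite setD11 /=; apply/eqP/idP => [<-|iS]; first by rewrite setU11.
  exact: setD1K.
- move=> S; rewrite setD11 /= => /eqP e; have iS : i \in S by rewrite -e setU11.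
  by rewrite setD1K // (setUidPr _) // sub1set.
Qed.

Lemma rho0 S z : rho S z = 0.
Proof.
have [->|ST] := eqVneq S setT; last exact: rho_proper.
have := sum_rho z; rewrite (bigD1 setT) //= big1 ?addr0 // => T TT.
exact: rho_proper.
Qed.

(** In [rho S z = 0] the terms with i outside [S] vanish by induction, and the others add up to f_S
    (hs S z). So f_S kills the multiples of [hs S], and [KK_base] applies. *)
Lemma upper_vanish :
  (forall S t, S != set0 -> valid (pv S) t -> f (W (wd l S) (ytau (pv S) t)) = 0) ->
  forall p, f p = 0.
Proof.
move=> ht; suff h S y : S != set0 -> fS S y = 0.
  apply: (@KK_descend r 2 Hstar 1 l) => // w y wl.
  have S0 : [set i in w] != set0.
    case: w wl => [|a w] /= wl; last by apply/set0Pn; exists a; rewrite inE mem_head.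
    by move: kl; rewrite -wl.
  by rewrite (@fS_word [set i in w]) ?h // => i; rewrite inE.
have [n] := ubnP (k - #|S|); elim: n S y => // n IH S y Sn S0.
have K1 : KK r (fS S).
  rewrite -[r in KK r]muln1; apply: (@KK_W r 2 Hstar 1) => //.
  by rewrite size_wd ?card_le_l.
apply: (KK_base r2 y r4 K1 S0) => [z|t vt]; last exact: ht.
have := rho0 S z; rewrite /rho (bigID (fun i => i \in S)) /=.
rewrite [X in _ + X]big1 ?addr0 => [|i iS]; last first.
  apply: IH; last by apply/set0Pn; exists i; rewrite setU11.
  have : (#|S| < k)%N.
    rewrite -[X in (_ < X)%N](card_ord k) -cardsT proper_card // properT.
    by apply: contraNneq iS => ->; rewrite inE.
  by rewrite cardsU1 iS; move: Sn; clear; lia.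
rewrite /hs mulr_suml (KK_sum _ _ _ K1) => h0; rewrite -[RHS]h0; apply: eq_bigr => i iS.
by congr fS; apply/esym/setUidPr; rewrite sub1set.
Qed.

End Upper.

(** As k <= d, every support has at most [d] elements, so all tests required by [upper_vanish] are
    indexed. *)
Lemma dimQP_le_cKD r d : (2 <= r)%N -> (r <= 4)%N ->
  (forall e, (2 <= e)%N -> star r e) -> (r.+1 <= d)%N ->
  (dimQP r.+1 (r * (2 ^ d.+1 - 1)) <= cKD r.+1 d.+1)%N.
Proof.
move=> r2 r4 Hstar rd; rewrite -(card_index r2).
apply: (@dimQP_le _ _ _ (fun x : index_type r d => test d (index_val x))) => f Kf hf.
apply: (@upper_vanish r r2 r4 Hstar d f rd Kf) => S t S0 vt.
have Sd := card_le_l rd S.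
case: t vt => [[E a]|] vt.
  have P2 : (0 < #|S| <= d)%N && valid (pv S) (Some (E, a)) by rewrite card_gt0 S0 Sd.
  by have := hf (inr (exist _ (S, (E, a)) P2)); rewrite /test /= Sd.
have P1 : (0 < #|S| <= d.+1)%N by rewrite card_gt0 S0 leqW.
by have := hf (inl (exist _ S P1)); rewrite /test /= Sd.
Qed.

(* The inequality and the cases of equality *)
Local Close Scope ring_scope.

Theorem mainTheorem1 (k d : nat) :
  3 <= k -> 1 <= d ->
  let n := ((k - 1) * (2 ^ d - 1))%N in
  cKD k d <= dimQP k n /\
  (dimQP k n = cKD k d <-> k = 3 \/ (k = 4 /\ 5 <= d) \/ (k = 5 /\ 6 <= d)).
Proof.
case: k => // r r2; case: d => // d _ n; rewrite /n {n} subn1 /=.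
have lo := cKD_le_dimQP r2 d; split=> //; split=> [eq_d|].
  have [->|r3] := eqVneq r 2; first by left.
  have {}r3 : 3 <= r by rewrite ltn_neqAle eq_sym r3.
  right; have [r5|r5] := leqP 5 r.
    have [d0|d0] := posnP d.
      by have := @cKD_lt_small r r2 d r3; rewrite eq_d ltnn d0 => /(_ isT).
    by have := cKD_lt_big r2 r5 d0; rewrite eq_d ltnn.
  (* The exponent of the statement is [d.+1], so [r.+1 <= d] gives the bounds 5 for k = 4 and 6 for
     k = 5. *)
  have [dr|dr] := ltnP d r.+1.
    by have := cKD_lt_small r2 r3 dr; rewrite eq_d ltnn.
  by clear -r3 r5 dr; lia.
case=> [[r_2]|[[[r_3] d5]|[[r_4] d6]]]; apply/eqP; rewrite eqn_leq lo andbT.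
- by rewrite r_2 dimQP3_le.
- by rewrite r_3 in r2 *; apply: dimQP_le_cKD => //; apply: star3.
- by rewrite r_4 in r2 *; apply: dimQP_le_cKD => //; apply: star4.
Qed.
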